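(* Let $n \geq 26$ and let $G$ be an Eulerian graph of order $n$ that is not a cycle. Then $W(G) \leq W(C_{n,3})$, with equality if and only if $G$ is isomorphic to $C_{n,3}$.
   Context: All graphs are finite and simple. A graph is Eulerian if it is connected and every vertex has even degree. For a connected graph $G$, $d_G(u,v)$ is the number of edges of a shortest $u$–$v$ path, and the Wiener index is $W(G)=\sum_{\{u,v\}\subseteq V(G)} d_G(u,v)$, the sum over all unordered pairs of distinct vertices. For $n\geq 5$, $C_{n,3}$ denotes the graph of order $n$ obtained from disjoint cycles $C_3$ and $C_{n-2}$ by identifying one vertex of $C_3$ with one vertex of $C_{n-2}$. *)

(* Defs.v *)
From mathcomp Require Import all_boot.

Set Implicit Arguments.
Unset Strict Implicit.
Unset Printing Implicit Defensive.

(* A graph is given by its adjacency relation on a finite type of vertices. *)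
Section Graphs.
Variable T : finType.
Implicit Type e : rel T.

Definition simple_graph e : Prop := symmetric e /\ irreflexive e.

Definition degree e (u : T) : nat := #|[set v | e u v]|.

Definition connected_graph e : Prop := forall u v, connect e u v.

Definition eulerian e : Prop :=
  connected_graph e /\ forall u, ~~ odd (degree e u).

(* A u-v path with k edges is determined by u and the k vertices after it. *)
Definition has_path e (u v : T) (k : nat) : bool :=
  [exists p : k.-tuple T, [&& path e u p, uniq (u :: p) & last u p == v]].

(* The least k with has_path e u v k: a path repeats no vertex, so k < #|T|.
   If there is no u-v path, which cannot happen in a connected graph, the
   value is the dummy #|T|. *)
Definition dist e (u v : T) : nat := find (has_path e u v) (iota 0 #|T|).

(* Each unordered pair of distinct vertices is counted once, listed in the
   order of the enumeration of T; dist e is symmetric when e is. *)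
Definition wiener e : nat :=
  \sum_(u : T) \sum_(v : T | enum_rank u < enum_rank v) dist e u v.

End Graphs.

Definition isomorphic (T U : finType) (e : rel T) (f : rel U) : Prop :=
  exists2 h : T -> U, bijective h & forall x y, f (h x) (h y) = e x y.

(* The cycle 0, 1, ..., k - 1, 0 as a relation on nat. *)
Definition cycle_adj (k i j : nat) : bool :=
  [&& i < k, j < k & (j == i.+1 %% k) || (i == j.+1 %% k)].

Definition cycle_graph (k : nat) : rel 'I_k := fun i j => cycle_adj k i j.

Definition is_cycle (T : finType) (e : rel T) : Prop :=
  exists2 k, 3 <= k & isomorphic e (@cycle_graph k).

(* C_{n,3}, meaningful for n >= 5: C_{n-2} on the vertices 0, ..., n - 3 and
   C_3 on the vertices 0, n - 2, n - 1, the two cycles sharing the vertex 0. *)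
Definition Cn3 (n : nat) : rel 'I_n := fun i j =>
  let triangle : seq nat := [:: 0; n - 2; n - 1] in
  cycle_adj (n - 2) i j
  || [&& val i \in triangle, val j \in triangle & i != j].

(* Main.v *)
(* Distances from a vertex x of a graph of order m are bounded through the sizes
   of the levels around x.  If no vertex cuts the graph, every level but the
   first and the last has two vertices, so the distances from x add up to at
   most f(m) = floor (m^2 / 4).  In a connected graph with even degrees two
   consecutive levels have at least three vertices, because an edge cut is
   never a single edge; the sum is then at most (m (m - 1) + 1) / 3.

   Suppose first that G has no cut vertex.  As G is not a cycle it has a vertex
   of degree at least 3, and G is a proper 2-connected induced subgraph H
   together with a path (an ear) through its q far_side vertices between two
   vertices of H; taking H as large as possible gives q + 2 <= |H|.  The level
   bound for H and the length of the ear bound W(G), which is enough if q >= 3.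
   If q = 2 the bound equals W(C_{n,3}) and parity saves one step.  If q = 1,
   parity gives H a vertex of degree at least 3 again, and H has an ear itself.

   If G has a cut vertex, take a smallest side B of a separation: it has no cut
   vertex.  The far_side side B' either has none, and W(G) is at most the Wiener
   index of two cycles sharing a vertex, which is largest when B is a triangle;
   or it is split again, and an induction on the order gives the cruder bound
   W <= (n^3 - 2 n^2 + 18 n) / 8, which applied to B' leaves enough room.
   Equality forces B' to be a cycle. *)

Require Import Defs.
From mathcomp Require Import all_boot zify.

Set Implicit Arguments.
Unset Strict Implicit.
Unset Printing Implicit Defensive.

(** * Distances in a finite graph *)

Section Distance.
Variables (T : finType) (r : rel T).
Implicit Types (x y z : T) (p : seq T).

(** [dist] searches only duplicate-free paths with fewer than [#|T|] edges, so a walk is first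
    shortened to such a path. *)
Lemma dist_le_path x p : path r x p -> dist r x (last x p) <= size p.
Proof.
case/shortenP=> p' rp' up' sub.
have szp : size p' <= size p by apply: uniq_leq_size => //; case/andP: up'.
apply: leq_trans szp; rewrite leqNgt; apply/negP => lt.
have ltT : size p' < #|T|.
  by have /card_uniqP := up'; move=> /= <-; apply: max_card.
have := before_find 0 lt; rewrite nth_iota // add0n /has_path => /existsP[].
by exists (in_tuple p'); rewrite rp' up' /=.
Qed.

Lemma dist_pathP x y :
  connect r x y -> exists2 p, path r x p & last x p = y /\ size p = dist r x y.
Proof.
case/connectP=> p0 /shortenP[p rp up _] ->.
have ltT : size p < #|T|.
  by have /card_uniqP := up; move=> /= <-; apply: max_card.
have hp : has (has_path r x (last x p)) (iota 0 #|T|).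
  apply/hasP; exists (size p); first by rewrite mem_iota.
  by apply/existsP; exists (in_tuple p); rewrite rp up /=.
have := nth_find 0 hp; rewrite nth_iota;
  last by rewrite has_find size_iota in hp.
rewrite add0n /has_path => /existsP[q /and3P[rq _ /eqP lq]].
by exists q; rewrite // size_tuple.
Qed.

Lemma dist_ltn x y : connect r x y -> dist r x y < #|T|.
Proof.
case/connectP=> p /shortenP[p' rp' up' _] ->.
apply: leq_ltn_trans (dist_le_path rp') _.
by have /card_uniqP := up'; move=> /= <-; apply: max_card.
Qed.

Lemma dist_refl x : dist r x x = 0.
Proof. by apply/eqP; rewrite -leqn0 (@dist_le_path x [::]). Qed.

Lemma dist_eq0 x y : connect r x y -> dist r x y = 0 -> x = y.
Proof. by case/dist_pathP=> p _ [<- <-] /size0nil->. Qed.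

Lemma dist_triangle y x z :
  connect r x y -> connect r y z -> dist r x z <= dist r x y + dist r y z.
Proof.
case/dist_pathP=> p rp [lp <-] /dist_pathP[q rq [<- <-]].
rewrite -size_cat -lp -last_cat; apply: dist_le_path.
by rewrite cat_path rp lp.
Qed.

Lemma dist_edge x y z :
  connect r x y -> r y z -> dist r x z <= (dist r x y).+1.
Proof.
move=> cxy ryz; apply: leq_trans (dist_triangle cxy (connect1 ryz)) _.
by rewrite -addn1 leq_add2l (@dist_le_path y [:: z]) //= ryz.
Qed.

Lemma dist1 x y : r x y -> dist r x y <= 1.
Proof. by move=> rxy; rewrite (@dist_le_path x [:: y]) //= rxy. Qed.

Lemma dist_pred x y :
  connect r x y -> x != y ->
  exists2 z, r z y & connect r x z /\ dist r x y = (dist r x z).+1.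
Proof.
move=> cxy xy; have [p] := dist_pathP cxy.
case/lastP: p => [_ [/= /eqP]|p w]; first by rewrite (negPf xy).
rewrite rcons_path last_rcons size_rcons => /andP[rp rw] [wy sz].
rewrite {}wy in rw; exists (last x p) => //.
have cp : connect r x (last x p) by apply/connectP; exists p.
split=> //; apply/eqP; rewrite eqn_leq (dist_edge cp rw) andTb.
by rewrite -sz ltnS; apply: dist_le_path.
Qed.

Lemma dist_geq1 x y : connect r x y -> x != y -> 0 < dist r x y.
Proof. by move=> cxy; case: posnP => // /(dist_eq0 cxy)->; rewrite eqxx. Qed.

(** A discrete intermediate value property. With g the distance from a fixed vertex, it makes a path
    meet every level in between. *)
Lemma path_hits_value (g : T -> nat) x p j :
  path r x p -> (forall a b, r a b -> g b <= (g a).+1) ->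
  g x <= j <= g (last x p) -> exists2 z, z \in x :: p & g z = j.
Proof.
move=> rp gS; elim: p x rp => [|y p IH] x /=.
  by move=> _ gj; exists x; rewrite ?mem_head //; lia.
case/andP=> rxy rp gj; have [gx|gx] := eqVneq (g x) j.
  by exists x; rewrite ?mem_head.
have /IH : path r y p by [].
case=> [|z zp gz]; first by have := gS _ _ rxy; lia.
by exists z => //; rewrite inE zp orbT.
Qed.

Lemma dist_sym x y : symmetric r -> connect r x y -> dist r x y = dist r y x.
Proof.
move=> rs; suff W a b : connect r a b -> dist r b a <= dist r a b.
  by move=> cxy; apply/eqP; rewrite eqn_leq !W // sym_connect_sym.
case/dist_pathP=> p rp [<- <-]; rewrite -(size_belast a) -size_rev.
rewrite -[X in dist _ _ X](_ : last (last a p) (rev (belast a p)) = a).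
  by apply: dist_le_path; rewrite rev_path (eq_path (e' := r)).
by case: p {rp} => //= z p; rewrite rev_cons last_rcons.
Qed.
End Distance.

Lemma dist_mono (T : finType) (r r' : rel T) x y :
  subrel r r' -> connect r x y -> dist r' x y <= dist r x y.
Proof.
move=> rr' /dist_pathP[p rp [<- <-]]; apply: dist_le_path.
exact: sub_path rp.
Qed.

Lemma eq_dist (T : finType) (r r' : rel T) :
  r =2 r' -> dist r =2 dist r'.
Proof.
move=> rr' x y; apply: eq_find => k; apply: eq_existsb => p.
by rewrite (eq_path rr').
Qed.

Lemma dist_iso (T U : finType) (r : rel T) (s : rel U) (h : T -> U) x y :
  bijective h -> (forall a b, s (h a) (h b) = r a b) ->
  (forall a b, connect r a b) -> dist s (h x) (h y) = dist r x y.
Proof.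
move=> [g gh hg] rs rc.
have cs a b : connect s a b.
  case/connectP: (rc (g a) (g b)) => p rp lp.
  apply/connectP; exists (map h p); last by rewrite -[a]hg last_map -lp hg.
  rewrite -[a]hg path_map.
  by rewrite (eq_path (e' := r)) // => u v /=; apply: rs.
apply/eqP; rewrite eqn_leq; apply/andP; split.
  have [p rp [<- <-]] := dist_pathP (rc x y).
  rewrite -last_map -(size_map h); apply: dist_le_path.
  by rewrite path_map (eq_path (e' := r)) // => u v /=; apply: rs.
have [p sp [lp <-]] := dist_pathP (cs (h x) (h y)).
rewrite -(gh y) -lp -(size_map g) -[X in dist _ X]gh -last_map.
apply: dist_le_path; rewrite path_map (eq_path (e' := s)) // => u v /=.
by rewrite -rs !hg.
Qed.

(** * Sums and polynomial bounds *)

(** Applied to distances and, with F the adjacency, to the handshake lemma. The estimates below work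
    with ordered pairs, which is why Wiener indices appear doubled. *)
Lemma sum_sym (T : finType) (X : {set T}) (F : T -> T -> nat) :
  {in X &, forall x y, F x y = F y x} -> {in X, forall x, F x x = 0} ->
  \sum_(x in X) \sum_(y in X) F x y =
  (\sum_(x in X) \sum_(y in X | enum_rank x < enum_rank y) F x y).*2.
Proof.
move=> Fs F0.
have split_row x : x \in X -> \sum_(y in X) F x y =
    \sum_(y in X | enum_rank x < enum_rank y) F x y +
    \sum_(y in X | enum_rank y < enum_rank x) F x y.
  move=> xX; rewrite (bigID (fun y => enum_rank x < enum_rank y)) /=;
    congr addn.
  rewrite (bigID (pred1 x)) /= (big1 _ (fun y => _ && (y == x))) ?add0n;
    last first.
    by move=> y /andP[_ /eqP->]; apply: F0.
  apply: eq_bigl => y; rewrite -leqNgt ltn_neqAle -andbA [_ && (y != x)]andbC.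
  by congr (_ && (~~ _ && _)); rewrite (inj_eq val_inj) (inj_eq enum_rank_inj).
rewrite (eq_bigr _ split_row) big_split /= -addnn; congr addn.
rewrite (exchange_big_dep (fun y => y \in X)) /=; last by move=> x y _ /andP[].
apply: eq_bigr => y yX; rewrite [LHS](eq_bigl (fun x =>
  (x \in X) && (enum_rank y < enum_rank x))); last by move=> x /=; rewrite yX.
by apply: eq_bigr => x /andP[xX _]; apply: Fs.
Qed.

(* The sum of the distances from a vertex of the cycle of length k. *)
Definition quarter k := k * k %/ 4.

Lemma quarter_ub k : 4 * quarter k <= k * k.
Proof. by rewrite /quarter; lia. Qed.

Lemma quarter_lb k : k * k <= 4 * quarter k + 1.
Proof.
rewrite /quarter; case: (odd_double_half k) => hk.
have [h kh] : exists h, k = 2 * h \/ k = 2 * h + 1.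
  by exists k./2; case: (odd k) hk; lia.
by case: kh => ->; nia.
Qed.

Lemma quarterS2 k : quarter k.+2 = quarter k + k.+1.
Proof. by rewrite /quarter (_ : _.+2 * _.+2 = k.+1 * 4 + k * k) ?divnMDl;
  lia. Qed.

Lemma quarterS k : 1 < k -> quarter k < quarter k.+1.
Proof. by rewrite /quarter => k1; have := quarter_lb k; rewrite /quarter;
  nia. Qed.

(** If the ball of radius i has at least 2 i + 1 of m vertices, the summands bound the numbers of
    vertices beyond it. Dropping one summand lowers m by two, as in [quarterS2]. *)
Lemma sum_odd_layers K m : \sum_(i < K) (m - (2 * i + 1)) <= quarter m.
Proof.
elim: K m => [|K IH] m; first by rewrite big_ord0.
rewrite big_ord_recl /= muln0 add0n.
case: m => [|[|m]]; try by rewrite big1 // => i _; lia.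
rewrite (eq_bigr (fun i : 'I_K => m - (2 * i + 1))); last first.
  by move=> i _; rewrite /bump /=; lia.
by rewrite quarterS2 addnC leq_add ?IH //; lia.
Qed.

(** Here the balls have at least 1, 3, 4, 6, 7, ... vertices: three more for every two radii, so the
    induction removes two summands at a time. *)
Lemma sum_3half_layers K m :
  3 * (\sum_(i < K) (m - (3 * i + 3) %/ 2)) <= m * (m - 1) + 1.
Proof.
elim/ltn_ind: K m => -[|[|K]] IH m.
- by rewrite big_ord0.
- rewrite big_ord1 /=; change ((3 * 0 + 3) %/ 2) with 1.
  by case: m => [|[|[|m]]]; nia.
rewrite big_ord_recl big_ord_recl /=.
change ((3 * 0 + 3) %/ 2) with 1; change ((3 * bump 0 0 + 3) %/ 2) with 3.
rewrite (eq_bigr (fun i : 'I_K => (m - 3) - (3 * i + 3) %/ 2)); last first.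
  by move=> i _; rewrite /bump /=; lia.
have := IH K _ (m - 3); rewrite ltnS leqnSn => /(_ isT).
move: (\sum_(i < K) (m - 3 - (3 * i + 3) %/ 2)) => S.
by case: m => [|[|[|m]]]; nia.
Qed.

(** The truncated differences add up to |i - j|, so the double sum is twice the Wiener index of a
    path on n vertices, here the inside of an ear. *)
Lemma sum_absdiff n :
  3 * (\sum_(i < n) \sum_(j < n) ((i - j) + (j - i))) + n = n * (n * n).
Proof.
elim: n => [|n IH]; first by rewrite big_ord0.
under eq_bigr do rewrite big_ord_recr /=.
rewrite big_split /= 2!big_ord_recr /= subnn !addn0.
have -> : \sum_(i < n) (n - i + (i - n)) = \sum_(i < n) (i - n + (n - i)).
  by apply: eq_bigr => i _; rewrite addnC.
have : 2 * \sum_(i < n) (i - n + (n - i)) = n * n.+1.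
  elim: n {IH} => [|n IH]; first by rewrite big_ord0.
  rewrite big_ord_recl /= (eq_bigr (fun i : 'I_n => i - n + (n - i))).
    by rewrite mulnDr IH subn0 sub0n; clear; nia.
  by move=> i _; rewrite /bump /=; lia.
move: IH; move: (\sum_(i < n) \sum_(j < n) _) => a.
by move: (\sum_(i < n) _) => b; clear; nia.
Qed.

(** A summand is the distance along an ear from its inner vertex i to the nearer end, or the
    distance from 0 to i + 1 on a cycle of length n + 1. *)
Lemma sum_min n : \sum_(i < n) minn i.+1 (n - i) = quarter n.+1.
Proof.
elim/ltn_ind: n => -[|[|n]] IH; rewrite ?big_ord0 ?big_ord1 //.
rewrite big_ord_recl big_ord_recr /= quarterS2 -IH //.
rewrite (eq_bigr (fun i : 'I_n => minn i.+1 (n - i) + 1)); last first.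
  by move=> i _; have := ltn_ord i; rewrite /bump /=; lia.
by rewrite big_split /= sum_nat_const card_ord /bump /=; lia.
Qed.

(* Twice the Wiener index of C_{n,3}. *)
Definition wiener2 n :=
  (n - 2) * quarter (n - 2) + 4 * quarter (n - 2) + 4 * n - 6.

(* Bounds the distances between an ear with q inner vertices and a 2-connected
   graph of order m. *)
Definition ear_cost m q := q * quarter m + m * quarter q.+1.

(* lia multiplies no hypotheses and reads monomials as unknowns, so it has to be
   told that they are nonnegative. *)
Ltac monomials a b :=
  have := leq0n (a * b); have := leq0n (a * a); have := leq0n (b * b);
  have := leq0n (a * (a * a)); have := leq0n (a * (a * b));
    have := leq0n (a * (b * b)).

(** With q = a + 3 and m = a + 5 + b the claim becomes polynomial in a, b >= 0 once each [quarter k]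
    is replaced by k^2 / 4, or by k^2 / 4 - 1 / 4 on the right. The other numerical estimates follow
    this scheme. *)
Lemma ear_cost_lt m q D : 2 < q -> q + 2 <= m -> 26 <= m + q ->
  3 * D + q = q * (q * q) ->
  m * quarter m + 2 * ear_cost m q + D < wiener2 (m + q).
Proof.
move=> q2 qm.
have [a qE] : exists a, q = a + 3 by exists (q - 3); lia.
have [b mE] : exists b, m = a + 5 + b by exists (m - q - 2); lia.
rewrite /wiener2 /ear_cost.
have -> : m + q - 2 = a + a + b + 6 by lia.
have -> : q.+1 = a + 4 by lia.
subst q m; clear.
have := quarter_ub (a + 5 + b); have := quarter_ub (a + 4).
have := quarter_lb (a + a + b + 6).
move: (quarter (a + a + b + 6)) (quarter (a + 4)) (quarter (a + 5 + b)).
move=> fn fq fm Hn Hq Hm n26 DE.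
(* For n = m + q the multipliers are n + 2, m and m + 2 q, the coefficients of the three [quarter]
   terms up to a factor 2 for the second. *)
have := leq_mul (leqnn (a + a + b + 10)) Hn.
have := leq_mul (leqnn (a + 5 + b)) Hq.
have := leq_mul (leqnn (a + a + a + b + 11)) Hm.
monomials a b; lia.
Qed.

(** For a graph of order m + q + 1: [2 * quarter (m + q).+1] pays for the distances at one deleted
    vertex, the other terms for the remaining graph and its ear. *)
Lemma ear_cost_lt1 m q D : 1 < q -> q + 2 <= m -> 25 <= m + q ->
  3 * D + q = q * (q * q) ->
  m * quarter m + 2 * ear_cost m q + D + 2 * quarter (m + q).+1 <
  wiener2 (m + q).+1.
Proof.
move=> q1 qm.
have [a qE] : exists a, q = a + 2 by exists (q - 2); lia.
have [b mE] : exists b, m = a + 4 + b by exists (m - q - 2); lia.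
rewrite /wiener2 /ear_cost.
have -> : (m + q).+1 - 2 = a + a + b + 5 by lia.
have -> : (m + q).+1 = a + a + b + 7 by lia.
have -> : q.+1 = a + 3 by lia.
subst q m; clear.
have := quarter_ub (a + 4 + b); have := quarter_ub (a + 3).
have := quarter_lb (a + a + b + 5); have := quarter_ub (a + a + b + 7).
move: (quarter (a + a + b + 5)) (quarter (a + 3)) (quarter (a + 4 + b)).
move: (quarter (a + a + b + 7)) => fN fn fq fm HN Hn Hq Hm n26 DE.
have := leq_mul (leqnn (a + a + b + 9)) Hn.
have := leq_mul (leqnn (a + 4 + b)) Hq.
have := leq_mul (leqnn (a + a + a + b + 8)) Hm.
monomials a b; lia.
Qed.

(* Bounds twice the Wiener index of two graphs of orders a and b sharing one
   vertex c: fa = floor (a^2 / 4) bounds the distance sums of the first; Wb is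
   twice the Wiener index and sb the distance sum of c in the second. *)
Definition glue_cost a fa Wb b sb :=
  a * fa + Wb + 2 * ((b - 1) * fa + (a - 1) * sb).

(** A triangle and a cycle sharing a vertex attain the gluing bound; this is how C_{n,3} enters the
    estimates. *)
Lemma glue_triangle n : 4 < n ->
  glue_cost 3 (quarter 3) ((n - 2) * quarter (n - 2)) (n - 2)
    (quarter (n - 2)) = wiener2 n.
Proof.
move=> n4; rewrite /glue_cost /wiener2 (_ : quarter 3 = 2) //.
have [k ->] : exists k, n = k + 3 by exists (n - 3); lia.
rewrite (_ : k + 3 - 2 = k + 1); last by lia.
by move: (quarter _) => f; lia.
Qed.

Lemma glue_lt a b : 3 < a -> a <= b -> 27 <= a + b ->
  glue_cost a (quarter a) (b * quarter b) b (quarter b) < wiener2 (a + b - 1).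
Proof.
move=> a3 ab.
have [x aE] : exists x, a = x + 4 by exists (a - 4); lia.
have [y bE] : exists y, b = x + 4 + y by exists (b - a); lia.
rewrite /wiener2 /glue_cost.
have -> : a + b - 1 - 2 = x + x + y + 5 by lia.
have -> : a - 1 = x + 3 by lia.
have -> : b - 1 = x + 3 + y by lia.
subst a b; clear.
have := quarter_ub (x + 4); have := quarter_ub (x + 4 + y).
have := quarter_lb (x + x + y + 5).
move: (quarter (x + 4)) (quarter (x + 4 + y)) (quarter (x + x + y + 5)).
move=> fa fb fn Hn Hb Ha n26.
have := leq_mul (leqnn (x + x + x + y + y + 10)) Ha.
have := leq_mul (leqnn (x + x + x + y + 10)) Hb.
have := leq_mul (leqnn (x + x + y + 9)) Hn.
monomials x y; lia.
Qed.

(* The bound (n^3 - 2 n^2 + 18 n) / 8 on the Wiener index W / 2. *)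
Definition cactus_bound n W := 4 * W + 2 * (n * n) <= n * (n * n) + 18 * n.

Lemma cactus_bound_glue a b : 2 < a -> a <= b ->
  cactus_bound (a + b - 1) (glue_cost a (quarter a)
    (b * quarter b) b (quarter b)).
Proof.
move=> a3 ab.
have [x aE] : exists x, a = x + 3 by exists (a - 3); lia.
have [y bE] : exists y, b = x + 3 + y by exists (b - a); lia.
rewrite /cactus_bound /glue_cost.
have -> : a + b - 1 = x + x + y + 5 by lia.
have -> : a - 1 = x + 2 by lia.
have -> : b - 1 = x + 2 + y by lia.
subst a b; clear.
have := quarter_ub (x + 3); have := quarter_ub (x + 3 + y).
move: (quarter (x + 3)) (quarter (x + 3 + y)) => fa fb Hb Ha.
have := leq_mul (leqnn (x + x + x + y + y + 7)) Ha.
have := leq_mul (leqnn (x + x + x + y + 7)) Hb.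
monomials x y; lia.
Qed.

(** Here the second graph may have cut vertices, so s only has the weaker bound that even degrees
    give. The first conclusion carries the induction on the order, the second gives strictness. The
    triangle is treated apart, with the exact value 2 of [quarter 3]. *)
Lemma cactus_bound_step a b W s : 2 < a -> a <= b -> 4 < b ->
  cactus_bound b W -> 3 * s <= b * (b - 1) + 1 ->
  cactus_bound (a + b - 1) (glue_cost a (quarter a) W b s) /\
  (27 <= a + b -> glue_cost a (quarter a) W b s < wiener2 (a + b - 1)).
Proof.
rewrite /cactus_bound /glue_cost /wiener2 leq_eqVlt => /orP[/eqP<- _|a4 ab _].
  move=> b4; have [y bE] : exists y, b = 5 + y by exists (b - 5); lia.
  rewrite (_ : quarter 3 = 2) //.
  have -> : 3 + b - 1 - 2 = y + 5 by lia.
  have -> : 3 + b - 1 = y + 7 by lia.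
  have -> : b - 1 = y + 4 by lia.
  subst b; clear; have := quarter_lb (y + 5); move: (quarter _) => fn Hn HW Hs.
  split; first lia.
  move=> n27; have := leq_mul (leqnn (y + 9)) Hn.
  have := leq_mul n27 (leqnn y); lia.
have [x aE] : exists x, a = x + 4 by exists (a - 4); lia.
have [y bE] : exists y, b = x + 4 + y by exists (b - a); lia.
have -> : a + b - 1 - 2 = x + x + y + 5 by lia.
have -> : a + b - 1 = x + x + y + 7 by lia.
have -> : a - 1 = x + 3 by lia.
have -> : b - 1 = x + 3 + y by lia.
subst a b; clear.
have := quarter_ub (x + 4); have := quarter_lb (x + x + y + 5).
move: (quarter (x + 4)) (quarter (x + x + y + 5)) => fa fn Hn Ha HW Hs.
have := leq_mul (leqnn (x + x + x + y + y + 10)) Ha.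
have := leq_mul (leqnn (x + 3)) Hs.
split.
  have yy : y <= y * y by case: (y) => // k; rewrite leq_pmulr.
  monomials x y; lia.
move=> n26; have := leq_mul (leqnn (x + x + y + 9)) Hn.
have := leq_mul n26 (leqnn x); have := leq_mul n26 (leqnn y).
monomials x y; lia.
Qed.

(** * Levels of induced subgraphs *)

Section Graph.
Variables (T : finType) (e : rel T).
Hypotheses (e_sym : symmetric e) (e_irr : irreflexive e).
Implicit Types (A B D X Z : {set T}) (a b c u v w x y z : T) (p s : seq T).

(** Subgraphs are relations on the whole of T, so that sides and ears need no subtypes; a vertex
    outside A is isolated. *)
Definition induced A : rel T := fun x y => [&& x \in A, y \in A & e x y].

Definition connected_on A :=
  [forall x in A, forall y in A, connect (induced A) x y].

(* Taking c outside A shows that A itself is connected as well. *)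
Definition two_connected A := (2 < #|A|) && [forall c, connected_on (A :\ c)].

Definition deg_on A x := #|[set y in A | e x y]|.

Definition even_on A := [forall x in A, ~~ odd (deg_on A x)].

Definition dist_sum A x := \sum_(y in A) dist (induced A) x y.

(** Over ordered pairs, hence twice the Wiener index of the subgraph induced by a connected A. *)
Definition dist_total A := \sum_(x in A) dist_sum A x.

Lemma connected_onP A : reflect {in A &, forall x y, connect (induced A) x y}
  (connected_on A).
Proof.
apply: (iffP forall_inP) => [H x y xA yA|H x xA].
  by have /forall_inP := H x xA; apply.
by apply/forall_inP=> y yA; apply: H.
Qed.

Lemma induced_sym A : symmetric (induced A).
Proof. by move=> x y; rewrite /induced e_sym andbCA. Qed.

Lemma induced_sub A B : A \subset B -> subrel (induced A) (induced B).
Proof.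
by move=> /subsetP AB x y /and3P[/AB xB /AB yB exy]; rewrite /induced xB yB.
Qed.

Lemma path_in A x p : x \in A -> path (induced A) x p -> {subset x :: p <= A}.
Proof.
elim: p x => [|y p IH] x xA /=; first by move=> _ z; rewrite inE => /eqP->.
case/andP=> /and3P[_ yA _] /(IH _ yA) sub z; rewrite inE => /orP[/eqP->//|].
exact: sub.
Qed.

Lemma tc_con A : two_connected A -> connected_on A.
Proof.
case/andP=> A3 /forallP tcA; apply/connected_onP=> x y xA yA.
have : 0 < #|A :\: [set x; y]|.
  by rewrite cardsDS ?cards2 ?subUset ?sub1set ?xA ?yA //; case: (_ != _); lia.
case/card_gt0P=> c; rewrite !inE negb_or => /andP[/andP[cx cy] cA].
have /connected_onP/(_ x y) := tcA c; rewrite !inE eq_sym cx eq_sym cy xA yA.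
move=> /(_ isT isT); apply: connect_sub => a b /(induced_sub (subsetDl _ _)).
exact: connect1.
Qed.

Lemma handshake X : ~~ odd (\sum_(x in X) deg_on X x).
Proof.
rewrite (eq_bigr (fun x => \sum_(y in X) e x y)); last first.
  by move=> x _; rewrite /deg_on -sum1dep_card big_mkcondr.
rewrite sum_sym ?odd_double // => [x y _ _|x _]; first by rewrite e_sym.
by rewrite e_irr.
Qed.

Lemma deg_split A X x : X \subset A ->
  deg_on A x = deg_on X x + deg_on (A :\: X) x.
Proof.
move=> XA; rewrite /deg_on -(cardsID X); congr (_ + _); apply: eq_card => y.
  rewrite !inE; case: (boolP (y \in X)) => yX; last by rewrite andbF.
  by rewrite (subsetP XA _ yX) andbT.
by rewrite !inE; do !case: (_ \in _).
Qed.

(** If a b were the only edge leaving X, the degrees in A would sum over X to twice the number of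
    edges inside X plus one, although each of them is even. *)
Lemma no_bridge A X a b :
  even_on A -> X \subset A -> a \in X -> b \in A :\: X -> e a b ->
  (forall x y, x \in X -> y \in A :\: X -> e x y -> x = a /\ y = b) -> False.
Proof.
move=> /forall_inP evA XA aX bX eab only.
have : ~~ odd (\sum_(x in X) deg_on A x).
  elim/big_ind: _ => // [m n|x xX]; first by rewrite oddD => /negPf-> /negPf->.
  by apply: evA; apply: (subsetP XA).
rewrite (eq_bigr _ (fun x _ => deg_split x XA)) big_split /= oddD.
rewrite (negPf (handshake X)) (bigD1 a) //= big1 ?addn0.
  rewrite /deg_on (_ : [set y in _ | _] = [set b]) ?cards1 //.
  apply/setP=> y; rewrite in_set1; apply/idP/eqP.
    by rewrite inE => /andP[yX eay]; have [] := only a y aX yX eay.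
  by move=> ->; rewrite inE bX eab.
move=> x /andP[xX xa]; apply: eq_card0 => y; rewrite inE.
by apply/negP=> /andP[yX exy]; have [/eqP] := only x y xX yX exy;
  rewrite (negPf xa).
Qed.

Section Levels.
Variables (A : {set T}) (x : T).
Hypotheses (cA : connected_on A) (xA : x \in A).
Let d := dist (induced A) x.

Let conx y : y \in A -> connect (induced A) x y.
Proof. by move=> yA; apply: (connected_onP _ cA). Qed.

Definition level j := [set y in A | d y == j].
Definition ball j := [set y in A | d y <= j].

Let d_edge a b : induced A a b -> d b <= (d a).+1.
Proof. by move=> ab; apply: dist_edge => //; apply: conx; case/and3P: ab. Qed.

Lemma level0 : level 0 = [set x].
Proof.
apply/setP=> y; rewrite !inE; apply/andP/eqP => [[yA /eqP /dist_eq0]|->].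
  by move=> /(_ (conx yA)).
by rewrite xA /d dist_refl.
Qed.

Lemma level1 : level 1 = [set y in A | e x y].
Proof.
apply/setP=> y; rewrite !inE; case yA: (y \in A) => //=;
  apply/eqP/idP => [dy|exy].
  have xy : x != y by apply/eqP=> xy; move: dy; rewrite /d -xy dist_refl.
  have [z rz [cz]] := dist_pred (conx yA) xy; rewrite -/d dy => -[] /esym.
  by move=> /(dist_eq0 cz) xz; move: rz; rewrite -xz => /and3P[].
apply/eqP; rewrite eqn_leq dist1 /induced ?xA ?yA //= dist_geq1 ?conx //.
by apply: contraTneq exy => ->; rewrite e_irr.
Qed.

Lemma card_ballS j : #|ball j.+1| = #|ball j| + #|level j.+1|.
Proof.
rewrite -cardsUI (_ : _ :&: _ = set0) ?cards0 ?addn0.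
  by apply: eq_card => y; rewrite !inE -andb_orr; congr (_ && _); lia.
by apply/setP=> y; rewrite !inE; case: (y \in A) => //=; lia.
Qed.

Lemma ball0 : ball 0 = [set x].
Proof. by rewrite -level0; apply/setP=> y; rewrite !inE leqn0. Qed.

Lemma level_neq0 j y : y \in A -> j <= d y -> exists2 z, z \in A & d z = j.
Proof.
move=> yA jy; case/connectP: (conx yA) => p rp lp.
case: (@path_hits_value _ (induced A) d x p j rp d_edge).
  by rewrite -lp jy /d dist_refl.
by move=> z zp dz; exists z => //; apply: path_in zp.
Qed.

(** If c were alone in level j, a path from x to y avoiding c could not get past that level. *)
Lemma tc_level j y : two_connected A -> y \in A -> 0 < j < d y ->
  1 < #|level j|.
Proof.
move=> /andP[_ /forallP tcA] yA /andP[j0 jy].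
have [c cinA dc] := level_neq0 yA (ltnW jy).
have cx : x != c by apply: contraTneq j0 => xc; rewrite -dc -xc /d dist_refl.
have cy : y != c by apply: contraTneq jy => ->; rewrite dc ltnn.
have /connected_onP/(_ x y) := tcA c; rewrite !inE cx cy xA yA.
move=> /(_ isT isT)/connectP[p rp lp].
case: (@path_hits_value _ (induced (A :\ c)) d x p j rp).
- by move=> a b /(induced_sub (subsetDl _ _)); apply: d_edge.
- by rewrite -lp (ltnW jy) /d dist_refl.
move=> z zp dz; apply/card_gt1P; exists c, z.
have : z \in A :\ c by apply: path_in zp => //; rewrite !inE cx.
rewrite !inE => /andP[zc zA]; rewrite cinA dc zA dz !eqxx.
by split=> //; rewrite eq_sym.
Qed.

(** If both levels were single vertices, the edge between them would be the only one leaving the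
    ball of radius j, against [no_bridge]. *)
Lemma even_levels j y : even_on A -> y \in A -> j < d y ->
  2 < #|level j| + #|level j.+1|.
Proof.
move=> evA yA jy; rewrite ltnNge; apply/negP=> le2.
have [b bA db] := level_neq0 yA jy.
have xb : x != b by apply/eqP=> xb; move: db; rewrite /d -xb dist_refl.
have [a /and3P[aA _ eab] [_ da]] := dist_pred (conx bA) xb.
rewrite -/d db in da; case: da => da.
have aL : a \in level j by rewrite inE aA da eqxx.
have bL : b \in level j.+1 by rewrite inE bA db eqxx.
have a1 : 0 < #|level j| by apply/card_gt0P; exists a.
have b1 : 0 < #|level j.+1| by apply/card_gt0P; exists b.
have /cards1P : #|level j| == 1 by move: le2 a1 b1; clear; lia.
case=> a' La; move: aL; rewrite La inE => /eqP aa'; subst a'.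
have /cards1P : #|level j.+1| == 1 by move: le2 a1 b1; clear; lia.
case=> b' Lb; move: bL; rewrite Lb inE => /eqP bb'; subst b'.
apply: (@no_bridge A (ball j) a b) => //.
- by apply/subsetP=> z; rewrite inE => /andP[].
- by rewrite inE aA da /=.
- by rewrite !inE bA db /= ltnn.
move=> u v; rewrite !inE => /andP[uA uj] /andP[+ vA] euv.
rewrite vA -ltnNge /= => vj.
have := @d_edge u v; rewrite /induced uA vA euv => /(_ isT) uv.
have : u \in level j by rewrite inE uA; move: uj uv vj; clear; lia.
have : v \in level j.+1 by rewrite inE vA; move: uj uv vj; clear; lia.
by rewrite La Lb !inE => /eqP-> /eqP->.
Qed.

(** A vertex at distance k lies outside exactly the balls of radius 0, ..., k - 1, and [#|T|] radii
    suffice because distances are below [#|T|]. *)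
Lemma sg_layers : dist_sum A x = \sum_(i < #|T|) (#|A| - #|ball i|).
Proof.
rewrite /dist_sum (eq_bigr (fun y => \sum_(i < #|T|) (i < d y))); last first.
  move=> y yA; have := dist_ltn (conx yA); rewrite -/d => lt.
  have -> N : \sum_(i < N) (i < d y) = minn (d y) N.
    by elim: N => [|N IH]; rewrite ?big_ord0 ?big_ord_recr /= ?IH; lia.
  by apply/esym/minn_idPl; apply: ltnW.
rewrite exchange_big /=; apply: eq_bigr => i _; move: (nat_of_ord i) => {}i.
rewrite -(cardsID (ball i) A) (_ : A :&: ball i = ball i); last first.
  by apply/setP=> y; rewrite !inE andbA andbb.
rewrite addKn -sum1_card [RHS](eq_bigl (fun y => (y \in A) && (i < d y)));
  last first.
  by move=> y; rewrite !inE; case: (y \in A) => //=; rewrite ltnNge andbT.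
by rewrite [RHS]big_mkcondr; apply: eq_bigr => y _; case: (_ < _).
Qed.
End Levels.

(** The subtraction is truncated, so the ball has to be large only when some vertex y of A lies
    beyond it. *)
Lemma layer_bound A x (g : nat -> nat) i :
  connected_on A -> x \in A ->
  (forall y, y \in A -> i < dist (induced A) x y -> g i <= #|ball A x i|) ->
  #|A| - #|ball A x i| <= #|A| - g i.
Proof.
move=> cA xA H; case: (posnP (#|A| - #|ball A x i|)) => [->//|pos].
apply: leq_sub2l; move: pos; rewrite -cardsDS; last by apply/subsetP=> y;
  rewrite inE => /andP[].
case/card_gt0P=> y; rewrite !inE => /andP[+ yA]; rewrite yA -ltnNge /=.
exact: H.
Qed.

Lemma card_ball1 A x : connected_on A -> x \in A ->
  #|ball A x 1| = (deg_on A x).+1.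
Proof. by move=> cA xA; rewrite card_ballS // ball0 // cards1 level1. Qed.

(** Level 1 has [deg_on A x] vertices, and every later level before that of y has at least two. *)
Lemma tc_ball A x y i : two_connected A -> x \in A -> y \in A ->
  i.+1 < dist (induced A) x y -> deg_on A x + (2 * i + 1) <= #|ball A x i.+1|.
Proof.
move=> tA xA yA; have cA := tc_con tA.
elim: i => [|i IH] id; first by rewrite card_ball1 //; lia.
rewrite card_ballS //; have := IH (ltnW id).
have := @tc_level A x cA xA i.+2 y tA yA; rewrite id => /(_ isT); lia.
Qed.

(** As A has at least three vertices, a vertex with at most one neighbour would leave some vertex
    beyond level 1, which then has two vertices by [tc_level]. *)
Lemma tc_deg A x : two_connected A -> x \in A -> 1 < deg_on A x.
Proof.
move=> tA xA; have cA := tc_con tA.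
have A2 : 2 < #|A| by case/andP: tA.
rewrite ltnNge; apply/negP=> d1.
have : 0 < #|A| - #|ball A x 1| by rewrite card_ball1 //; lia.
rewrite -cardsDS; last by apply/subsetP=> y; rewrite inE => /andP[].
case/card_gt0P=> y; rewrite !inE => /andP[+ yA]; rewrite yA -ltnNge /= => yd.
by have := @tc_level A x cA xA 1 y tA yA yd; rewrite level1 // ltnNge d1.
Qed.

Lemma tc_sg A x : two_connected A -> x \in A -> dist_sum A x <= quarter #|A|.
Proof.
move=> tA xA; have cA := tc_con tA; rewrite sg_layers //.
apply: leq_trans (sum_odd_layers #|T| _); apply: leq_sum => i _.
apply: (@layer_bound A x (fun i => 2 * i + 1)) => // y yA.
case: (nat_of_ord i) => [|j] jd; first by rewrite ball0 ?cards1.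
by have := tc_ball tA xA yA jd; have := tc_deg tA xA; lia.
Qed.

(** A third neighbour raises the lower bound for every ball of positive radius by one, so after the
    first summand the estimate is that of order [#|A| - 3] instead of [#|A| - 2]. *)
Lemma tc_sg_strict A x :
  two_connected A -> x \in A -> 3 < #|A| -> 2 < deg_on A x ->
    dist_sum A x < quarter #|A|.
Proof.
move=> tA xA A3 d3; have cA := tc_con tA; rewrite sg_layers //.
case E: #|T| => [|K].
  by rewrite big_ord0 /quarter; nia.
rewrite big_ord_recl ball0 // cards1.
have : \sum_(i < K) (#|A| - #|ball A x (lift ord0 i)|) <= quarter (#|A| - 3).
  apply: leq_trans (sum_odd_layers K _); apply: leq_sum => i _.
  apply: leq_trans (_ : #|A| - (2 * i + 4) <= _); last by lia.
  rewrite (_ : nat_of_ord (lift ord0 i) = i.+1) //.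
  apply: leq_trans (@layer_bound A x (fun i => 2 * i + 2) i.+1 cA xA _) _;
    last by lia.
  by move=> y yA jd; have := tc_ball tA xA yA jd; lia.
case: #|A| A3 => [|[|[|[|m]]]] // _; rewrite quarterS2.
have := @quarterS m.+1; case: m => [|m]; first by rewrite /quarter /=; lia.
by rewrite !subSS subn0 => /(_ isT); lia.
Qed.

Lemma even_ball A x y i : connected_on A -> even_on A -> x \in A -> y \in A ->
  i < dist (induced A) x y -> 3 * i + 2 <= 2 * #|ball A x i|.
Proof.
move=> cA evA xA yA; elim/ltn_ind: i => -[|[|i]] IH id.
- by rewrite ball0 // cards1.
- have := @even_levels A x cA xA 0 y evA yA (ltnW id).
  by rewrite card_ballS // ball0 // level0 // cards1; lia.
have := @even_levels A x cA xA i.+1 y evA yA (ltnW id).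
have := IH i; rewrite !card_ballS //; lia.
Qed.

Lemma even_sg A x : connected_on A -> even_on A -> x \in A ->
  3 * dist_sum A x <= #|A| * (#|A| - 1) + 1.
Proof.
move=> cA evA xA; rewrite sg_layers //.
apply: leq_trans (sum_3half_layers #|T| _); rewrite leq_pmul2l //.
apply: leq_sum => i _.
apply: (@layer_bound A x (fun i => (3 * i + 3) %/ 2)) => // y yA id.
by have := even_ball cA evA xA yA id; lia.
Qed.

(** * Ears of 2-connected graphs *)

Lemma path_ind A x p : path e x p -> {subset x :: p <= A} ->
  path (induced A) x p.
Proof.
elim: p x => //= y p IH x /andP[exy ep] sub;
  rewrite /induced !sub ?inE ?eqxx ?orbT //.
by rewrite exy IH // => z zp; apply: sub; rewrite inE zp orbT.
Qed.

Lemma con_from A z : (forall x, x \in A -> connect (induced A) z x) ->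
  connected_on A.
Proof.
move=> H; apply/connected_onP=> x y xA yA; apply: connect_trans (H y yA).
by rewrite (sym_connect_sym (induced_sym A)) H.
Qed.

Lemma path_con s : sorted e s -> connected_on [set x in s].
Proof.
case: s => [|y s] /= ep; first by apply/connected_onP=> x y; rewrite !inE.
apply: (@con_from _ y) => x; rewrite inE => xs.
case/splitPl: xs ep => p1 p2 <-; rewrite cat_path => /andP[ep1 _].
apply/connectP; exists p1 => //; apply: path_ind => // z zp.
by rewrite !inE mem_cat; move: zp; rewrite inE orbA => ->.
Qed.

Lemma tc_cycle s : uniq s -> 2 < size s -> cycle e s ->
  two_connected [set x in s].
Proof.
move=> us s3 cs; apply/andP; split; first by rewrite cardsE (card_uniqP us).
apply/forallP=> c; case: (boolP (c \in s)) => cs'; last first.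
  rewrite (_ : _ :\ c = [set x in s]).
    by case: s cs {us s3 cs'} => [|y s] cs; apply: path_con => //=;
       move: cs; rewrite /= rcons_path => /andP[].
  by apply/setP=> x; rewrite !inE; case: eqP => //= ->; rewrite (negPf cs').
have [i p ip] := rot_to cs'.
have : uniq (c :: p) by rewrite -ip rot_uniq.
have : cycle e (c :: p) by rewrite -ip rot_cycle.
rewrite /= => cp /andP[cNp _].
rewrite (_ : _ :\ c = [set x in p]).
  apply: path_con; case: p cp {ip cNp} => //= a p.
  by rewrite rcons_path => /and3P[].
apply/setP=> x; rewrite !inE -(mem_rot i) ip inE.
by case: eqP => //= ->; rewrite (negPf cNp).
Qed.

(** Whatever vertex c is deleted, a common vertex of A and B survives, and both remainders are
    connected to it. *)
Lemma tc_union A B : two_connected A -> two_connected B -> 1 < #|A :&: B| ->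
  two_connected (A :|: B).
Proof.
move=> /andP[A3 /forallP cA] /andP[B3 /forallP cB] AB.
apply/andP; split;
  first by apply: leq_trans A3 (subset_leq_card (subsetUl _ _)).
apply/forallP=> c.
have [z zAB zc] : exists2 z, z \in A :&: B & z != c.
  case/card_gt1P: AB => a [b [aAB bAB ab]].
  by have [ac|] := eqVneq a c; [exists b; rewrite // -ac eq_sym | exists a].
case/setIP: zAB => zA zB.
apply: (@con_from _ z) => x; rewrite !inE => /andP[xc /orP[xA|xB]].
  have /connected_onP/(_ z x) := cA c; rewrite !inE xA xc zA zc => /(_ isT isT).
  apply: connect_sub => a b ab; apply: connect1; apply: induced_sub ab.
  by apply: setSD; apply: subsetUl.
have /connected_onP/(_ z x) := cB c; rewrite !inE xB xc zB zc => /(_ isT isT).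
apply: connect_sub => a b ab; apply: connect1; apply: induced_sub ab.
by apply: setSD; apply: subsetUr.
Qed.

Lemma first_hit A Z x y :
  x \in A -> x \notin Z -> y \in Z -> connect (induced A) x y ->
  exists p z, [/\ path e x p, uniq (x :: p), {subset x :: p <= A :\: Z},
                  z \in A :&: Z & e (last x p) z].
Proof.
move=> xA xZ yZ /connectP[p0 ap ly].
suff [p [z [ep sub zAZ lz]]] : exists p z, [/\ path e x p,
    {subset x :: p <= A :\: Z}, z \in A :&: Z & e (last x p) z].
  case/shortenP: ep lz => p' ep' up' sub' lz; exists p', z; split=> // a.
  by rewrite inE => /orP[/eqP->|/sub' ap']; apply: sub;
    rewrite inE ?eqxx ?ap' ?orbT.
elim: p0 x xA xZ ap ly => [|w p0 IH] x xA xZ /=; first by move=> _ yx;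
  rewrite -yx yZ in xZ.
case/andP=> /and3P[_ wA exw] ap ly; case: (boolP (w \in Z)) => wZ.
  exists [::], w; split=> //; last by rewrite inE wA.
  by move=> a; rewrite inE => /eqP->; rewrite inE xZ.
have [p [z [ep sub zAZ lz]]] := IH w wA wZ ap ly.
exists (w :: p), z; split=> //=; first by rewrite exw.
by move=> a; rewrite inE => /orP[/eqP->|/sub//]; rewrite inE xZ.
Qed.

(** A path in A minus x from a neighbour a of x to the first other neighbour z closes to a cycle
    through x. It contains no neighbour of x but a and z, so a third one is left out. *)
Lemma tc_proper_cycle A x : two_connected A -> x \in A -> 2 < deg_on A x ->
  exists2 B, two_connected B & B \proper A.
Proof.
move=> /andP[_ /forallP tA] xA dx.
set N := [set y in A | e x y] in (dx).
have [a aN] : exists a, a \in N by apply/card_gt0P; apply: leq_trans dx.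
have : 1 < #|N :\ a| by move: dx; rewrite /deg_on -/N (cardsD1 a) aN; clear;
  lia.
have NE b : b \in N -> [/\ b \in A, b != x & e x b].
  rewrite inE => /andP[bA exb]; split=> //.
  by apply: contraTneq exb => ->; rewrite e_irr.
case/card_gt1P=> b [b' [bZ b'Z bb']].
have [aA ax exa] := NE _ aN.
have [_ bN] := setD1P bZ; have [bA bx exb] := NE _ bN.
have [] := @first_hit (A :\ x) (N :\ a) a b; rewrite ?inE ?eqxx ?ax ?aA //.
- by have := setD1P bZ; rewrite inE => -[-> /andP[-> ->]].
- by have /connected_onP := tA x; apply; rewrite !inE ?ax ?aA ?bx ?bA.
move=> p [z [ep up sub]] /setIP[_ zZ] lz.
have [za zN] := setD1P zZ; have [zA zx exz] := NE _ zN.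
pose s := x :: a :: rcons p z.
have xNp : x \notin a :: p.
  by apply/negP=> /sub; rewrite !inE eqxx andbF.
have zNp : z \notin a :: p by apply/negP=> /sub; rewrite inE zZ.
have es : cycle e s.
  by rewrite /s /= !rcons_path last_rcons exa ep lz e_sym exz.
have us : uniq s.
  rewrite (_ : s = x :: rcons
    (a :: p) z) // cons_uniq mem_rcons in_cons negb_or.
  by rewrite [x == z]eq_sym zx xNp rcons_uniq zNp up.
have sA : {subset s <= A}.
  move=> c; rewrite !(inE, mem_rcons) => /or4P[/eqP->//|/eqP->//|/eqP->//|cp].
  by have : c \in a :: p; [rewrite inE cp orbT | case/sub/setDP=> /setD1P[]].
have [d dZ dz] : exists2 d, d \in N :\ a & d != z.
  have [bz|] := eqVneq b z; last by exists b.
  by exists b'; rewrite // -bz eq_sym.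
have [da dN] := setD1P dZ; have [dA dx' _] := NE _ dN.
exists [set c in s]; first by apply: tc_cycle => //; rewrite /s /= size_rcons.
apply/properP; split; first by apply/subsetP=> c; rewrite inE => /sA.
exists d => //; rewrite inE /s !(inE, mem_rcons) (negPf dx') (negPf da)
  (negPf dz) /=.
apply/negP=> dp; have : d \in a :: p by rewrite inE dp orbT.
by case/sub/setDP=> _; rewrite dZ.
Qed.

(** The levels strictly between u and v have at least two vertices each, so a shortest path from u
    to v cannot span A. *)
Lemma tc_path_proper A u v :
  two_connected A -> u \in A -> v \in A -> (dist (induced A) u v).+1 < #|A|.
Proof.
move=> tA uA vA; have A2 : 2 < #|A| by case/andP: tA.
case E: (dist (induced A) u v) => [|[|i]]; try by move: A2; clear; lia.
have := @tc_ball A u v i tA uA vA.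
rewrite E => /(_ (leqnn _)).
have := tc_deg tA uA; set D := deg_on A u.
have : #|ball A u i.+1| < #|A|.
  apply: proper_card; apply/properP; split.
    by apply/subsetP=> y; rewrite inE => /andP[].
  by exists v; rewrite // inE vA E ltnn.
move: #|ball _ _ _| D #|A|; clear; lia.
Qed.

(** Only the edges along the ear are recorded. Its inner vertices s may have further neighbours,
    which can only shorten distances. *)
Record ear A A' u v s : Prop := Ear {
  ear_sub : A' \subset A;
  ear_mem : A :\: A' =i s;
  ear_l : u \in A';
  ear_r : v \in A';
  ear_neq : u != v;
  ear_uniq : uniq s;
  ear_path : path e u s;
  ear_last : e (last u s) v }.

(** A' is a largest proper 2-connected subset. A path outside A' between two of its vertices u and
    v, closed by a shortest path inside A', gives a cycle B. Maximality is used twice: A' together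
    with B is all of A, and B, being proper, is no larger than A', which bounds the ear. *)
Lemma ear_decomposition A x : two_connected A -> x \in A -> 2 < deg_on A x ->
  exists A' u v s, [/\ two_connected A', ear A A' u v s, 0 < size s & size s + 2 <= #|A'|].
Proof.
move=> tA xA dx; have [B0 tB0 pB0] := tc_proper_cycle tA xA dx.
pose P (B : {set T}) := two_connected B && (B \proper A).
have PB0 : P B0 by rewrite /P tB0.
case: (arg_maxnP (fun B : {set T} => #|B|) PB0) => A' /andP[tA' pA'] Amax.
have sA' := proper_sub pA'; have A'3 : 2 < #|A'| by case/andP: (tA').
have [w0 w0A w0A'] : exists2 w, w \in A & w \notin A' by case/properP: pA'.
have [a aA'] : exists a, a \in A' by apply/card_gt0P; apply: leq_trans A'3.
have aA := subsetP sA' _ aA'.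
have caw : connect (induced A) w0 a by apply: (connected_onP _ (tc_con tA)).
have [p0 [u [_ _ sub0 /setIP[uA uA'] lu]]] := first_hit w0A w0A' aA' caw.
set w := last w0 p0 in lu.
have /setDP[wA wA'] : w \in A :\: A' by apply: sub0; apply: mem_last.
have wu : w != u by apply: contraNneq wA' => ->.
have [v0] : exists v, v \in A' :\ u.
  by apply/card_gt0P; move: A'3; rewrite (cardsD1 u A') uA'; clear; lia.
rewrite !inE => /andP[v0u v0A'].
have [] := @first_hit (A :\ u) A' w v0; rewrite ?inE ?wu ?wA ?wA' //.
  case/andP: tA => _ /forallP/(_ u)/connected_onP; apply;
    rewrite !inE ?wu ?v0u //.
  exact: (subsetP sA').
move=> p [v [ep up sub]] /setIP[vAu vA'] lv.
have [vu vA] := setD1P vAu.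
have ewu : e u w by rewrite e_sym.
have uv : u != v by rewrite eq_sym.
have /dist_pathP[q] : connect (induced A') v u by apply: (connected_onP _
  (tc_con tA')).
move=> qA' [lq dq]; case/shortenP: qA' lq => q' q'A' uq' subq lq.
have szq : size q' <= dist (induced A') v u.
  by rewrite -dq; apply: uniq_leq_size => //; case/andP: uq'.
have sq' : {subset v :: q' <= A'} by apply: path_in q'A'.
pose s := (w :: p) ++ (v :: q').
have es : cycle e s.
  rewrite /s /= rcons_path cat_path last_cat /= lq ewu ep lv andbT /=.
  by apply: sub_path q'A' => b c /and3P[].
have sN z : z \in w :: p -> (z \in A) && (z \notin A').
  by move=> /sub; rewrite !inE => /and3P[-> _ ->].
have us : uniq s.
  rewrite cat_uniq up uq' andbT; apply/hasPn=> z /sq' zA'.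
  by apply/negP=> /sN; rewrite zA' andbF.
have sA : {subset s <= A}.
  by move=> z; rewrite mem_cat => /orP[/sN/andP[]|/sq'/(subsetP sA')].
set B := [set z in s].
have tB : two_connected B.
  apply: tc_cycle => //; rewrite /s size_cat /=.
  by case: q' lq {q'A' uq' subq szq sq' s es us sA B} => /= [/eqP|];
    [rewrite (negPf vu)|clear; lia].
have BA : B \subset A by apply/subsetP=> z; rewrite inE => /sA.
have cardB : #|B| = size p + size q' + 2.
  by rewrite cardsE (card_uniqP us) /s size_cat /=; clear; lia.
(* If B were A, the shortest path from v to u in A' would contain all of A', against
   [tc_path_proper]. *)
have pB : B \proper A.
  rewrite properEneq BA andbT; apply/eqP=> BAeq.
  have := tc_path_proper tA' vA' uA'.
  have : A' \subset [set z in v :: q'].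
    apply/subsetP=> z zA'; have := subsetP sA' _ zA'.
    rewrite -BAeq [_ \in B]inE /s mem_cat => /orP[/sN|];
      first by rewrite zA' andbF.
    by rewrite inE.
  move=> /subset_leq_card; rewrite cardsE (card_uniqP uq') /= => le.
  by apply/negP; rewrite -leqNgt; apply: leq_trans le _; rewrite ltnS;
    apply: szq.
have uB : u \in B by rewrite inE /s mem_cat -lq (mem_last v q') orbT.
have vB : v \in B by rewrite inE /s mem_cat mem_head orbT.
have wB : w \in B by rewrite inE /s mem_head.
have AE : A' :|: B = A.
  apply/eqP/negPn/negP => ne.
  have /Amax : P (A' :|: B).
    rewrite /P properEneq ne subUset sA' BA !andbT; apply: tc_union => //.
    by apply/card_gt1P; exists u, v; split=> //; apply/setIP.
  apply/negP; rewrite -ltnNge; apply: proper_card; rewrite properUl //.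
  by apply/subsetPn; exists w.
exists A', u, v, (w :: p); split=> //=.
  split=> //; last by rewrite /= ewu.
  move=> z; rewrite inE; apply/andP/idP => [[zA']|/sN/andP[]//].
  rewrite -AE inE (negPf zA') [_ \in B]inE /s mem_cat => /or3P[//|//|/sq'].
  by rewrite (negPf zA').
have /Amax : P B by rewrite /P tB.
rewrite cardB; have q'0 : 0 < size q' by case: (q') lq => //= /eqP;
  rewrite (negPf vu).
  by move: (size q') q'0 #|A'|; clear; lia.
Qed.

(** * Distance sums across an ear *)

Local Notation d A := (dist (induced A)).

Lemma dC A x y : connected_on A -> x \in A -> y \in A -> d A x y = d A y x.
Proof.
by move=> /connected_onP cA xA yA; apply: dist_sym;
  [apply: induced_sym | apply: cA].
Qed.

Lemma d_sub A B x y : B \subset A -> connected_on B -> x \in B -> y \in B ->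
  d A x y <= d B x y.
Proof.
by move=> BA /connected_onP cB xB yB; apply: dist_mono;
  [apply: induced_sub | apply: cB].
Qed.

Lemma d_tri A x y z : connected_on A -> x \in A -> y \in A -> z \in A ->
  d A x z <= d A x y + d A y z.
Proof. by move=> /connected_onP cA xA yA zA; apply: dist_triangle;
  apply: cA. Qed.

Lemma W2_split A A' : connected_on A -> A' \subset A ->
  dist_total A = \sum_(x in A') \sum_(y in A') d A x y +
         2 * (\sum_(w in A :\: A') \sum_(x in A') d A w x) +
         \sum_(w in A :\: A') \sum_(w' in A :\: A') d A w w'.
Proof.
move=> cA sA'.
have spl (F : T -> nat) :
    \sum_(x in A) F x = \sum_(x in A') F x + \sum_(x in A :\: A') F x.
  rewrite (big_setID A') /= (_ : A :&: A' = A') //.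
  by apply/setIidPr.
rewrite /dist_total /dist_sum spl; under eq_bigr do rewrite spl.
rewrite big_split /=; under [X in _ + X]eq_bigr do rewrite spl.
rewrite big_split /= [X in _ + X + _]exchange_big /=.
rewrite [X in _ + X + _](eq_bigr (fun w => \sum_(x in A') d A w x)); last first.
  move=> w /setDP[wA _]; apply: eq_bigr => x xA'; apply: dC => //.
  exact: (subsetP sA').
by rewrite addnA mul2n -addnn !addnA.
Qed.

Lemma W2_sub A A' : connected_on A' -> A' \subset A ->
  \sum_(x in A') \sum_(y in A') d A x y <= dist_total A'.
Proof. by move=> cA' sA'; do 2![apply: leq_sum => ? ?]; apply: d_sub. Qed.

Lemma W2_del1 A w : connected_on A -> connected_on (A :\ w) -> w \in A ->
  dist_total A <= dist_total (A :\ w) + 2 * dist_sum A w.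
Proof.
move=> cA cA' wA; rewrite (W2_split cA (subsetDl A [set w])).
have -> : A :\: (A :\ w) = [set w].
  by apply/setP=> x; rewrite !inE; case: eqP => [->|_]; rewrite ?wA //=;
    case: (x \in A).
rewrite !big_set1 dist_refl addn0 leq_add ?W2_sub ?subsetDl //.
rewrite leq_pmul2l // /dist_sum [X in _ <= X](bigD1 w) //= dist_refl add0n.
by rewrite leq_eqVlt; apply/orP; left; apply/eqP; apply: eq_bigl => x;
   rewrite !inE andbC.
Qed.

Lemma tc_W2 A : two_connected A -> dist_total A <= #|A| * quarter #|A|.
Proof.
by move=> tA; rewrite -sum_nat_const; apply: leq_sum => x; apply: tc_sg.
Qed.

(* A vertex next to two vertices u and v of A' saves one step on its way to v. *)
Lemma adj2_sum A A' w u v : connected_on A -> A' \subset A ->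
  connected_on A' -> w \in A ->
  u \in A' -> v \in A' -> u != v -> e w u -> e w v ->
  \sum_(x in A') d A w x < #|A'| + dist_sum A' u.
Proof.
move=> cA sA' cA' wA uA' vA' uv ewu ewv; have sA := subsetP sA'.
have d1 z : z \in A' -> e w z -> d A w z <= 1.
  by move=> zA' ewz; apply: dist1; rewrite /induced wA sA.
rewrite -sum1_card -big_split /= (bigD1 v) //= [X in _ < X](bigD1 v) //=.
rewrite -addSn leq_add //.
  by rewrite ltnS (leq_trans (d1 _ vA' ewv)) // dist_geq1 //;
    apply: (connected_onP _ cA').
apply: leq_sum => x /andP[xA' _].
apply: leq_trans (d_tri cA wA (sA _ uA') (sA _ xA')) _.
by rewrite leq_add ?d1 ?d_sub.
Qed.

Section Ear.
Variables (A A' : {set T}) (u v : T) (s : seq T).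
Hypotheses (cA : connected_on A) (tA' : two_connected A') (E : ear A A' u v s).
Let m := #|A'|.
Let q := size s.
Let sA' := ear_sub E.
Let uA' := ear_l E.
Let vA' := ear_r E.
Let cA' := tc_con tA'.

Lemma ear_big (F : T -> nat) :
  \sum_(w in A :\: A') F w = \sum_(i < q) F (nth u s i).
Proof.
rewrite (eq_bigl (mem s)); last by move=> w; apply: (ear_mem E).
by rewrite -big_uniq ?(ear_uniq E) //= (big_nth u) big_mkord.
Qed.

Lemma ear_in i : i < q -> nth u s i \in A.
Proof. by move=> /(mem_nth u); rewrite -(ear_mem E) => /setDP[]. Qed.

Lemma ear_step i : i.+1 < q -> e (nth u s i) (nth u s i.+1).
Proof. by move=> iq; have /(pathP u)/(_ i.+1 iq) := ear_path E. Qed.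

Lemma ear_first : 0 < q -> e u (nth u s 0).
Proof. by move=> q0; have /(pathP u)/(_ 0 q0) := ear_path E. Qed.

Lemma ear_dist i j : i + j < q -> d A (nth u s i) (nth u s (i + j)) <= j.
Proof.
elim: j => [|j IH] ijq; first by rewrite addn0 dist_refl.
rewrite addnS in ijq *.
apply: leq_trans (d_tri cA (ear_in _) (ear_in (ltnW ijq)) (ear_in ijq)) _;
  first by lia.
rewrite -[j.+1]addn1 leq_add ?IH ?(ltnW ijq) //.
by apply: dist1; rewrite /induced !ear_in ?(ltnW ijq) // ear_step.
Qed.

Lemma ear_dist_l i : i < q -> d A (nth u s i) u <= i.+1.
Proof.
move=> iq; have uA := subsetP sA' _ uA'; rewrite dC ?ear_in //.
have q0 : 0 < q by apply: leq_ltn_trans iq.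
apply: leq_trans (d_tri cA uA (ear_in q0) (ear_in iq)) _.
rewrite -add1n leq_add ?(@ear_dist 0) //.
by apply: dist1; rewrite /induced uA ear_in // ear_first.
Qed.

Lemma ear_dist_r i : i < q -> d A (nth u s i) v <= q - i.
Proof.
move=> iq; have vA := subsetP sA' _ vA'.
have q1 : q.-1 < q by case: (q) iq.
apply: leq_trans (d_tri cA (ear_in iq) (ear_in q1) vA) _.
have -> : q - i = (q.-1 - i) + 1 by move: iq; clear; lia.
rewrite leq_add //; last first.
  apply: dist1; rewrite /induced vA ear_in //= nth_last.
  by case: (s) (ear_last E) iq.
have E' : q.-1 = i + (q.-1 - i) by move: iq; clear; lia.
by rewrite {1}E' ear_dist // -E'.
Qed.

Lemma ear_sum_via i z : i < q -> z \in A' ->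
  \sum_(x in A') d A (nth u s i) x <= m * d A (nth u s i) z + dist_sum A' z.
Proof.
move=> iq zA'; have sA := subsetP sA'.
rewrite -sum_nat_const -big_split /=; apply: leq_sum => x xA'.
apply: leq_trans (d_tri cA (ear_in iq) (sA _ zA') (sA _ xA')) _.
by apply: leq_add => //; apply: d_sub.
Qed.

Lemma ear_sum i : i < q ->
  \sum_(x in A') d A (nth u s i) x <= m * minn i.+1 (q - i) + quarter m.
Proof.
move=> iq.
have via z k : z \in A' -> d A (nth u s i) z <= k ->
    \sum_(x in A') d A (nth u s i) x <= m * k + quarter m.
  move=> zA' dk; apply: leq_trans (ear_sum_via iq zA') _.
  by rewrite leq_add ?leq_mul // tc_sg.
by case: (leqP i.+1 (q - i)) => _; [apply: (via u) | apply: (via v)];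
   rewrite ?ear_dist_l ?ear_dist_r.
Qed.

(** Pairs inside A' keep at most their distance in A', mixed pairs go through the nearer end of the
    ear, and pairs inside the ear go along it; D is the sum of the last kind for a path. *)
Lemma ear_W2 : exists2 D, 3 * D + q = q * (q * q) &
  dist_total A <= m * quarter m + 2 * ear_cost m q + D.
Proof.
exists (\sum_(i < q) \sum_(j < q) ((i - j) + (j - i))).
  exact: sum_absdiff.
rewrite (W2_split cA sA') ear_big leq_add //; last first.
  rewrite ear_big; apply: leq_sum => i _; rewrite ear_big;
    apply: leq_sum => j _.
  wlog ij : i j / i <= j.
    move=> W; case: (leqP i j) => [/W//|/ltnW/W].
    by rewrite addnC dC ?ear_in ?ltn_ord.
  rewrite (eqP (_ : i - j == 0)) ?subn_eq0 // add0n.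
  by rewrite -{1}(subnKC ij) ear_dist // subnKC.
rewrite leq_add ?leq_pmul2l //.
  exact: leq_trans (W2_sub cA' sA') (tc_W2 tA').
have -> : ear_cost m q = \sum_(i < q) (m * minn i.+1 (q - i) + quarter m).
  by rewrite big_split /= sum_nat_const card_ord -big_distrr /= sum_min addnC.
by apply: leq_sum => i _; apply: ear_sum.
Qed.

Lemma ear_card : #|A| = m + q.
Proof.
rewrite -(cardsID A') (_ : A :&: A' = A'); last by apply/setIidPr.
by congr (_ + _); rewrite (eq_card (ear_mem E)) (card_uniqP (ear_uniq E)).
Qed.

(* An ear with one inner vertex: the vertex sees both ends. *)
Lemma ear1_W2 : q = 1 -> dist_total A + 2 <= m * quarter m + 2 * ear_cost m 1.
Proof.
move=> q1; rewrite (W2_split cA sA') !ear_big.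
have uA := subsetP sA' _ uA'.
have q0 : 0 < q by rewrite q1.
rewrite q1 !big_ord1 ear_big q1 big_ord1 dist_refl addn0 /=.
have ew : e u (nth u s 0) by apply: ear_first.
have ewv : e (nth u s 0) v.
  have := ear_last E; move: q1; rewrite /q.
  by case: (s) => [|w [|? ?]].
have := adj2_sum cA sA' cA' (ear_in q0) uA' vA' (ear_neq E).
rewrite e_sym => /(_ ew ewv).
have := tc_sg tA' uA'; have := W2_sub cA' sA'; have := tc_W2 tA'.
rewrite /ear_cost -/m (_ : quarter 2 = 1) // muln1 mul1n.
move: (\sum_(x in A') \sum_(y in A') _) (dist_total _) => a b.
by move: (\sum_(x in A') _) (dist_sum _ _) (quarter m) => c w f; clear; lia.
Qed.

(** An even degree less one is odd, and a 2-connected graph has no vertex of degree 1. *)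
Lemma odd_deg_ear : even_on A -> deg_on (A :\: A') u = 1 -> 2 < deg_on A' u.
Proof.
move=> /forall_inP evA d1; have := evA _ (subsetP sA' _ uA').
rewrite (deg_split u sA') d1 oddD addbT negbK.
by have := tc_deg tA' uA'; case: deg_on => [|[|[]]].
Qed.

(* Either u sees both inner vertices, or u has odd degree in A'; both save one
   step. *)
Lemma ear2_W2 : q = 2 -> even_on A -> 3 < m ->
  dist_total A + 2 <= m * quarter m + 2 * ear_cost m 2 + 2.
Proof.
move=> q2 evA m3; rewrite (W2_split cA sA') !ear_big.
have uA := subsetP sA' _ uA'.
have q0 : 0 < q by rewrite q2.
have q1 : 1 < q by rewrite q2.
have := W2_sub cA' sA'; have := tc_W2 tA'.
have := ear_dist (q1 : 0 + 1 < q); rewrite add0n => d01.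
have := d01; rewrite dC ?ear_in // => d10.
have S0 := ear_sum q0; have S1 := ear_sum q1.
have : \sum_(x in A') d A (nth u s 0) x + \sum_(x in A') d A (nth u s 1) x <
       2 * m + 2 * quarter m.
  have [euw|euw] := boolP (e u (nth u s 1)).
    have ewv : e (nth u s 1) v.
      have := ear_last E; move: q2; rewrite /q.
      by case: (s) => [|? [|w [|? ?]]].
    have := adj2_sum cA sA' cA' (ear_in q1) uA' vA' (ear_neq E).
    rewrite e_sym => /(_ euw ewv).
    have := tc_sg tA' uA'; move: S0; rewrite q2 -/m /=.
    by move: (\sum_(x in A') _) => a;
      move: (\sum_(x in A') _) (dist_sum _ _) (quarter m); clear; lia.
  have d3 : 2 < deg_on A' u.
    apply: odd_deg_ear => //; rewrite /deg_on.
    rewrite (_ : [set y in _ | _] = [set nth u s 0]) ?cards1 //.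
    apply/setP=> y; rewrite !inE -in_setD (ear_mem E).
    apply/andP/eqP => [[ys euy]|->]; last by rewrite mem_nth // ear_first.
    have [k k2 yk] : exists2 k, k < 2 & nth u s k = y.
      by exists (index y s); rewrite ?nth_index // -q2 index_mem.
    by move: euy; rewrite -yk; case: k k2 {yk} => [|[|]] //;
      rewrite (negPf euw).
  have := tc_sg_strict tA' uA' m3 d3; have := ear_sum_via q0 uA'.
  have := ear_dist_l q0; move: S1; rewrite q2 -/m /=.
  move: (\sum_(x in A') _) => a; move: (\sum_(x in A') _) => b.
  by move: (d _ _ _) (dist_sum _ _) (quarter m) m; clear; nia.
rewrite q2 !(big_ord_recr, big_ord0) /= !ear_big q2.
rewrite !(big_ord_recr, big_ord0) /= !dist_refl !add0n !addn0.
move: (\sum_(x in A') \sum_(y in A') _) (dist_total _) => a b.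
move: (\sum_(x in A') _) => a1; move: (\sum_(x in A') _) => a2.
rewrite /ear_cost -/m (_ : quarter 3 = 2) //.
by move: (d _ _ _) d01 (d _ _ _) d10 (quarter m); clear; lia.
Qed.
End Ear.

Lemma tc_W2_lt A x : two_connected A -> even_on A -> x \in A ->
  2 < deg_on A x ->
  26 <= #|A| -> dist_total A < wiener2 #|A|.
Proof.
move=> tA evA xA dx n26; have cA := tc_con tA.
have [A' [u [v [s [tA' E q0 szs]]]]] := ear_decomposition tA xA dx.
have cardA := ear_card E.
have [q2|q2] := ltnP 2 (size s).
  have [D DE WD] := ear_W2 cA tA' E.
  rewrite cardA in n26 *; apply: leq_ltn_trans WD _.
  exact: ear_cost_lt.
have : size s = 1 \/ size s = 2 by move: q0 q2; clear; lia.
case=> q12; last first.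
  have : 3 < #|A'| by move: cardA n26; rewrite q12; clear; lia.
  move=> m3; have := ear2_W2 cA tA' E q12 evA m3; rewrite cardA q12.
  rewrite /ear_cost /wiener2 addnK (_ : quarter 3 = 2) //.
  by move: (dist_total _) (quarter _); clear; lia.
pose w := nth u s 0; have wA : w \in A by apply: (ear_in E); rewrite q12.
have A'E : A' = A :\ w.
  have sw : s = [:: w] by rewrite /w; case: (s) q12 => [|? []].
  apply/setP=> y; rewrite !inE; case: (boolP (y \in A)) => yA; last first.
    rewrite andbF; apply: contraNF yA; exact: (subsetP (ear_sub E)).
  have := ear_mem E y; rewrite sw !inE yA andbT => <-.
  by rewrite negbK ?andbT.
(* The neighbour w is the only one that u loses in A', so parity makes [ear_decomposition]
   applicable to A' as well. *)
have dA'u : 2 < deg_on A' u.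
  apply: (odd_deg_ear tA' E evA).
  rewrite /deg_on (_ : [set y in _ | _] = [set w]) ?cards1 //.
  apply/setP=> y; rewrite in_set1 inE (ear_mem E).
  have sw : s = [:: w] by rewrite /w; case: (s) q12 => [|? []].
  rewrite {1}sw inE; case: eqP => // ->.
  by rewrite /w (ear_first E) // q12.
have n25 : 25 <= #|A'| by move: cardA n26; rewrite q12; clear; lia.
have Wdel : dist_total A <= dist_total A' + 2 * quarter #|A|.
  have cA' : connected_on (A :\ w) by rewrite -A'E tc_con.
  apply: leq_trans (W2_del1 cA cA' wA) _; rewrite -A'E leq_add2l leq_pmul2l //.
  exact: tc_sg.
have [B [u' [v' [s' [tB E' q0' szs']]]]] :=
  ear_decomposition tA' (ear_l E) dA'u.
have cA' := tc_con tA'; have cardA' := ear_card E'.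
apply: leq_ltn_trans Wdel _.
have [q2'|q2'] := ltnP 1 (size s').
  have [D DE WD] := ear_W2 cA' tB E'.
  rewrite cardA q12 addn1 cardA' in n25 *.
  apply: leq_ltn_trans (leq_add WD (leqnn _)) _.
  exact: ear_cost_lt1.
have q1' : size s' = 1 by move: q0' q2'; clear; lia.
(* Two successive ears with one inner vertex: without the two units saved by [ear1_W2] the bound
   would be exactly [wiener2]. *)
have := ear1_W2 cA' tB E' q1'; rewrite cardA q12 cardA' q1'.
rewrite /ear_cost /wiener2 (_ : quarter 2 = 1) // addn1 addn1 quarterS2.
rewrite (_ : #|B|.+2 - 2 = #|B|); last by clear; lia.
by move: (dist_total _) (quarter _); clear; lia.
Qed.

(** * Cut vertices *)

(** The side B contains the cut vertex c, and B minus c may consist of several components of A minus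
    c. *)
Definition separation A c B :=
  [&& c \in B, 1 < #|B|, B \proper A &
      [forall x in B :\ c, forall y in A :\: B, ~~ e x y]].

Definition far_side A c B := c |: (A :\: B).

Lemma separationP A c B : separation A c B ->
  [/\ c \in B, 1 < #|B|, B \subset A, c \in A &
      forall x y, x \in B -> x != c -> y \in A -> y \notin B -> ~~ e x y].
Proof.
case/and4P=> cB B1 pB /forall_inP H; have sB := proper_sub pB; split=> //.
  exact: (subsetP sB).
move=> x y xB xc yA yB; have := H x; rewrite !inE xc xB => /(_ isT)/forall_inP.
by apply; rewrite inE yB.
Qed.

Lemma sep_other A c B : separation A c B -> separation A c (far_side A c B).
Proof.
move=> S; have [cB B1 sB cA nE] := separationP S.
have [w wA wB] : exists2 w, w \in A & w \notin B by case/and4P: S =>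
  _ _ /properP[].
have [b bB bc] : exists2 b, b \in B & b != c.
  case/card_gt1P: B1 => x [y [xB yB xy]].
  by have [xc|] := eqVneq x c; [exists y; rewrite // -xc eq_sym | exists x].
apply/and4P; split.
- by rewrite !inE eqxx.
- apply/card_gt1P; exists c, w; rewrite !inE eqxx wA wB orbT; split=> //.
  by apply: contraNneq wB => <-.
- apply/properP; split.
    by apply/subsetP=> y; rewrite !inE => /orP[/eqP->//|/andP[]].
  by exists b; [apply: (subsetP sB) | rewrite !inE (negPf bc) bB].
apply/forall_inP=> x; rewrite !inE => /andP[xc];
  rewrite (negPf xc) => /andP[xB xA].
apply/forall_inP=> y;
  rewrite !inE negb_or negb_and negbK => /andP[/andP[yc yB] yA].
by rewrite yA orbF in yB; rewrite e_sym; apply: nE.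
Qed.

Lemma con_deg A x y : connected_on A -> x \in A -> y \in A -> x != y ->
  0 < deg_on A x.
Proof.
move=> /connected_onP cA xA yA xy; case/connectP: (cA x y xA yA) => -[|z p] /=.
  by move=> _ yx; rewrite yx eqxx in xy.
by case/andP=> /and3P[_ zA exz] _ _; apply/card_gt0P; exists z; rewrite inE zA.
Qed.

(** A positive even degree means at least two neighbours. *)
Lemma even_con_card A : connected_on A -> even_on A -> 1 < #|A| -> 2 < #|A|.
Proof.
move=> cA /forall_inP evA A1; have /card_gt1P[x [y [xA yA xy]]] := A1.
have := evA x xA; have := con_deg cA xA yA xy.
have : deg_on A x <= #|A :\ x|.
  apply/subset_leq_card/subsetP=> z; rewrite !inE => /andP[-> exz].
  by rewrite andbT; apply: contraTneq exz => ->; rewrite e_irr.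
move: A1; rewrite (cardsD1 x A) xA; move: (deg_on A x) #|A :\ x|.
by clear; case=> [|[|a]] //; lia.
Qed.

Lemma exists_sep A : connected_on A -> 2 < #|A| -> ~~ two_connected A ->
  exists c B, separation A c B.
Proof.
move=> cA A2; rewrite /two_connected A2 /= => /forallPn[c].
case/forall_inPn=> x xAc /forall_inPn[y yAc nxy].
have [xc xA] := setD1P xAc; have [yc yA] := setD1P yAc.
have cinA : c \in A.
  apply: contraNT nxy => cA'; have -> : A :\ c = A.
    by apply/setP=> z; rewrite !inE; case: eqP => //= ->; rewrite (negPf cA').
  exact: (connected_onP _ cA).
(* The side is c together with the component of x in A minus c. *)
exists c, (c |: [set z in A :\ c | connect (induced (A :\ c)) x z]);
  apply/and4P; split.
- by rewrite !inE eqxx.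
- apply/card_gt1P; exists c, x; rewrite !inE eqxx xc xA connect0 orbT;
  split=> //.
  by rewrite eq_sym.
- apply/properP; split.
    by apply/subsetP=> z; rewrite !inE => /orP[/eqP->//|/andP[/andP[]]].
  by exists y => //; rewrite !inE (negPf yc) yA /=.
apply/forall_inP=> a; rewrite !inE => /andP[ac].
rewrite (negPf ac) /= => /andP[aA xa].
apply/forall_inP=> b; rewrite !inE negb_or negb_and => /andP[/andP[bc nb] bA].
rewrite bc bA /= in nb; apply: contraNN nb => eab; apply: connect_trans xa _.
by apply: connect1; rewrite /induced !inE ac aA bc bA.
Qed.

(** A path in A from a vertex of B to c cannot leave B before it first meets c. *)
Lemma sep_con A c B : connected_on A -> separation A c B -> connected_on B.
Proof.
move=> cA S; have [cB _ sB cinA nE] := separationP S.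
apply: (con_from (z := c)) => x xB.
have [->|xc] := eqVneq x c; first exact: connect0.
have xA := subsetP sB _ xB.
have [||p [z [ep _ sub /setIP[_ /set1P->] lc]]] :=
  @first_hit A [set c] x c xA _ _ (connected_onP _ cA _ _ xA cinA);
    rewrite ?inE //.
rewrite (sym_connect_sym (induced_sym B)).
have {}sub : {subset x :: p <= B}.
  elim: p x xB xc {xA} ep sub {lc} => [|y p IH] x xB xc /=.
    by move=> _ _ w; rewrite inE => /eqP->.
  case/andP=> exy ep sub.
  have : y \in A :\ c by apply: sub; rewrite !inE eqxx orbT.
  rewrite !inE => /andP[yc yA].
  have yB : y \in B by apply: contraTT exy; apply: nE.
  move=> w; rewrite inE => /orP[/eqP->//|]; apply: IH => // v vp.
  by apply: sub; rewrite inE vp orbT.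
apply: connect_trans (connect1 (_ : induced B (last x p) c)).
  by apply/connectP; exists p => //; apply: path_ind.
by rewrite /induced cB lc sub ?mem_last.
Qed.

(** Vertices of B other than c keep all their neighbours, hence their even degrees; the handshake
    lemma in B then settles c. *)
Lemma sep_even A c B : even_on A -> separation A c B -> even_on B.
Proof.
move=> /forall_inP evA S; have [cB _ sB cinA nE] := separationP S.
have evx x : x \in B -> x != c -> ~~ odd (deg_on B x).
  move=> xB xc; have := evA x (subsetP sB _ xB).
  rewrite (deg_split x sB) (_ : deg_on (A :\: B) x = 0) ?addn0 //.
  apply: eq_card0 => y; rewrite !inE; apply/negP=> /andP[/andP[yB yA]].
  by apply/negP; apply: nE.
apply/forall_inP=> x xB; have [->|] := eqVneq x c; last exact: evx.
have := handshake B; rewrite (bigD1 c) //= oddD.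
suff /negPf-> : ~~ odd (\sum_(i in B | i != c) deg_on B i) by rewrite addbF.
elim/big_ind: _ => // [m n|i /andP[]];
  first by rewrite oddD => /negPf-> /negPf->.
exact: evx.
Qed.

(** If B had a cut vertex c', one of the two sides there would avoid c, or c' = c. Minus c' such a
    side has no neighbours outside B either, so it is a smaller side of A. *)
Lemma min_sep_tc A c B : connected_on A -> even_on A -> separation A c B ->
  (forall c' D, separation A c' D -> #|B| <= #|D|) -> two_connected B.
Proof.
move=> cA evA S Bmin; have [cB B1 sB cinA nE] := separationP S.
have cB' := sep_con cA S; have B2 := even_con_card cB' (sep_even evA S) B1.
apply/negPn/negP=> /(exists_sep cB' B2)[c' [D SD]].
wlog cD : D SD / (c \notin D) || (c == c').
  move=> W; have [cD|cD] := boolP ((c \notin D) || (c == c'));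
    first exact: W SD cD.
  have := W _ (sep_other SD); apply; move: cD; rewrite !inE negb_or negbK.
  by case/andP=> -> /negPf->.
have [c'D D1 sD c'B nD] := separationP SD;
  have pD : D \proper B by case/and4P: SD.
have /Bmin : separation A c' D.
  apply/and4P; split=> //; first exact: proper_sub_trans pD sB.
  apply/forall_inP=> x; rewrite !inE => /andP[xc' xD]; apply/forall_inP=> y.
  rewrite inE => /andP[yD yA]; have [yB|yB] := boolP (y \in B).
    exact: nD.
  apply: nE => //; first exact: (subsetP sD).
  by case/orP: cD => [cD|/eqP->//]; apply: contraNneq cD => <-.
by rewrite leqNgt proper_card.
Qed.

Lemma card_other A c B : separation A c B ->
  #|A| = #|B| + #|far_side A c B| - 1.
Proof.
move=> S; have [cB _ sB _ _] := separationP S.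
rewrite cardsU1 !inE cB /= -(cardsID B A) (_ : A :&: B = B).
  by clear; lia.
exact/setIidPr.
Qed.

(** Distances between the two sides are bounded through c; pairs within one side keep at most their
    distance there. *)
Lemma W2_glue A c B : connected_on A -> separation A c B ->
  dist_total A <= dist_total B + dist_total (far_side A c B) +
    2 * ((#|far_side A c B| - 1) * dist_sum B c + (#|B| - 1) * dist_sum
      (far_side A c B) c).
Proof.
move=> cA S; have [cB _ sB cinA _] := separationP S.
have S' := sep_other S; set B' := far_side A c B in S' *.
have [cB'  _ sB' _ _] := separationP S'.
have DE : A :\: B = B' :\ c.
  apply/setP=> y; rewrite /B' /far_side !inE.
  by case: eqP => [->|] //=; rewrite cB.
have conB := sep_con cA S; have conB' := sep_con cA S'.
rewrite (W2_split cA sB) DE.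
(* The cross sum already contains the pairs of c with the rest of B', so they are separated from
   [dist_total B']; this accounts for the factor [#|B| - 1]. *)
have s1B' : [set c] \subset B' by rewrite sub1set.
have := W2_split conB' s1B'; rewrite !big_set1 dist_refl add0n.
under eq_bigr do rewrite big_set1; move=> WB'.
have SE : \sum_(w in B' :\ c) d B' w c = dist_sum B' c.
  rewrite /dist_sum [RHS](bigD1 c) //= dist_refl add0n.
  rewrite (eq_bigl (fun w => (w \in B') && (w != c))); last first.
    by move=> w; rewrite !inE andbC.
  by apply: eq_bigr => w /andP[wB' _]; apply: dC.
have cardD : #|B' :\ c| = #|B'| - 1 by rewrite (cardsD1 c B') cB' add1n subn1.
have sub y : y \in B' :\ c -> y \in B' by case/setD1P.
have cross : \sum_(w in B' :\ c) \sum_(x in B) d A w x <=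
    #|B| * dist_sum B' c + (#|B'| - 1) * dist_sum B c.
  rewrite -cardD -SE big_distrr -sum_nat_const -big_split /=.
  apply: leq_sum => w /sub wB'.
  rewrite -sum_nat_const -big_split /=; apply: leq_sum => x xB.
  apply: leq_trans (d_tri cA (subsetP sB' _ wB') cinA (subsetP sB _ xB)) _.
  by apply: leq_add; apply: d_sub.
have inner : \sum_(w in B' :\ c) \sum_(w' in B' :\ c) d A w w' <=
             \sum_(w in B' :\ c) \sum_(w' in B' :\ c) d B' w w'.
  by apply: leq_sum => w /sub wB'; apply: leq_sum => w' /sub w'B'; apply: d_sub.
have B0 : 0 < #|B| by apply/card_gt0P; exists c.
have := W2_sub conB sB; rewrite WB' SE.
move: B0 cross inner; move: (\sum_(w in B' :\ c) \sum_(x in B) _) => a1.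
move: (\sum_(w in B' :\ c) \sum_(w' in B' :\ c) d A _ _) => a2.
move: (\sum_(w in B' :\ c) \sum_(w' in B' :\ c) d B' _ _) => a3.
move: (\sum_(x in B) _) (dist_total B) (dist_sum B c) (dist_sum B' c) #|B| =>
  a4 w s s' [//|b] _.
by move: ((#|B'| - 1) * s) => t; rewrite subn1 mulSn /=; clear; lia.
Qed.

Lemma exists_split A : connected_on A -> even_on A -> 2 < #|A| ->
  ~~ two_connected A ->
  exists c B, [/\ separation A c B, two_connected B & #|B| <= #|far_side A c B|].
Proof.
move=> cA evA A2 nA; have [c0 [B0 S0]] := exists_sep cA A2 nA.
pose P (cB : T * {set T}) := separation A cB.1 cB.2.
have P0 : P (c0, B0) by [].
case: (arg_minnP (fun cB : T * {set T} => #|cB.2|) P0) => -[c B] /= S Bmin.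
have {}Bmin c' D : separation A c' D -> #|B| <= #|D| by move=> S';
  apply: (Bmin (c', D)).
exists c, B; split=> //; first exact: (min_sep_tc cA evA S).
by apply: Bmin; apply: sep_other.
Qed.

Lemma W2_glue_cost A c B : connected_on A -> separation A c B ->
  two_connected B ->
  dist_total A <= glue_cost #|B| (quarter #|B|)
    (dist_total (far_side A c B)) #|far_side A c B|
            (dist_sum (far_side A c B) c).
Proof.
move=> cA S tB; apply: leq_trans (W2_glue cA S) _.
have [cB _ _ _ _] := separationP S.
rewrite /glue_cost leq_add ?leq_add2r ?tc_W2 //.
by rewrite leq_pmul2l // leq_add2r leq_mul // tc_sg.
Qed.

(** Induction on the order: a smallest side is 2-connected, and the far side either is too or
    satisfies the bound already. In the latter case [even_sg] bounds its distance sum at c. *)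
Lemma cactus_W2 A : connected_on A -> even_on A -> 2 < #|A| ->
  ~~ two_connected A ->
  4 < #|A| /\ cactus_bound #|A| (dist_total A).
Proof.
have [n] := ubnP #|A|; elim: n A => // n IH A An cA evA A2 nA.
have [c [B [S tB le]]] := exists_split cA evA A2 nA.
have AE := card_other S; have W := W2_glue_cost cA S tB.
have B2 : 2 < #|B| by case/andP: tB.
have S' := sep_other S; set B' := far_side A c B in S' le AE W *.
have cB' := sep_con cA S'; have evB' := sep_even evA S'.
have [cinB' _ _ _ _] := separationP S'.
have A4 : 4 < #|A| by rewrite AE; move: #|B| #|B'| B2 le; clear; lia.
split=> //.
have mono W' : dist_total A <= W' -> cactus_bound #|A| W' ->
  cactus_bound #|A| (dist_total A).
  by rewrite /cactus_bound => le1; apply: leq_trans;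
    rewrite leq_add2r leq_pmul2l.
apply: (mono _ W); rewrite AE; have [tB'|nB'] := boolP (two_connected B').
  have := cactus_bound_glue B2 le; rewrite /cactus_bound; apply: leq_trans.
  rewrite leq_add2r leq_pmul2l // /glue_cost leq_add //.
    by rewrite leq_add2l tc_W2.
  by rewrite leq_pmul2l // leq_add2l leq_mul // tc_sg.
have B'n : #|B'| < n by move: An AE; move: #|A| #|B| #|B'| B2; clear; lia.
have [B'4 cb] := IH _ B'n cB' evB' (leq_trans B2 le) nB'.
by have [] := cactus_bound_step B2 le B'4 cb (even_sg cB' evB' cinB').
Qed.

(** If B is larger than a triangle or the far side has a cut vertex, the numerical bounds are
    strict. There remains a triangle glued to a 2-connected graph. *)
Lemma extremal_split A : connected_on A -> even_on A -> 26 <= #|A| ->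
  ~~ two_connected A ->
  dist_total A < wiener2 #|A| \/ dist_total A <= wiener2 #|A| /\
  exists c B, let B' := far_side A c B in
  [/\ separation A c B, #|B| = 3, two_connected B, two_connected B' &
      dist_total A = wiener2 #|A| -> dist_total B' = #|B'| * quarter #|B'|].
Proof.
move=> cA evA A26 nA; have A2 : 2 < #|A| by apply: leq_trans A26.
have [c [B [S tB le]]] := exists_split cA evA A2 nA.
have AE := card_other S; have W := W2_glue_cost cA S tB.
have B2 : 2 < #|B| by case/andP: tB.
have S' := sep_other S; set B' := far_side A c B in S' le AE W *.
have cB' := sep_con cA S'; have evB' := sep_even evA S'.
have [cinB' _ _ _ _] := separationP S'.
have n27 : 27 <= #|B| + #|B'|.
  by move: AE A26; move: #|A| #|B| #|B'| B2; clear; lia.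
have [tB'|nB'] := boolP (two_connected B'); last first.
  left; apply: leq_ltn_trans W _; rewrite AE.
  have [B'4 cb] := cactus_W2 cB' evB' (leq_trans B2 le) nB'.
  have [_] := cactus_bound_step B2 le B'4 cb (even_sg cB' evB' cinB').
  exact.
have WB' := tc_W2 tB'; have sB' := tc_sg tB' cinB'.
have [B3|B3] := ltnP 3 #|B|.
  left; rewrite AE; apply: leq_ltn_trans (glue_lt B3 le n27).
  apply: leq_trans W _; rewrite /glue_cost leq_add //.
    by rewrite leq_add2l.
  by rewrite leq_pmul2l // leq_add2l leq_mul.
have {B2}B3 : #|B| = 3 by apply/eqP; rewrite eqn_leq B3.
have B'E : #|B'| = #|A| - 2 by move: AE n27; rewrite B3; move: #|A| #|B'|;
  clear; lia.
have glE := @glue_triangle #|A| (leq_trans (isT : 4 < 26) A26).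
(* Whatever [dist_total B'] lacks to its maximum is also lacking in the bound for A, so equality for
   A forces equality for B'. *)
have le1 : glue_cost #|B| (quarter #|B|) (dist_total B') #|B'| (dist_sum B' c) +
    #|B'| * quarter #|B'| <= wiener2 #|A| + dist_total B'.
  rewrite -glE B3 -B'E /glue_cost;
    move: (3 * quarter 3) ((#|B'| - 1) * quarter 3) sB' => a b.
  by move: (quarter #|B'|) (dist_sum B' c) (dist_total B') #|B'|; clear; lia.
right; split; first by move: W le1 WB'; clear; lia.
exists c, B; split=> // WE; apply/eqP; rewrite eqn_leq WB' /=.
by rewrite -(leq_add2l (wiener2 #|A|)) (leq_trans _ le1) // leq_add2r -WE.
Qed.

(** * Cycles and the extremal graph *)

Lemma index_next s x : uniq s -> x \in s ->
  index (next s x) s = (index x s).+1 %% size s.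
Proof.
case: s => // c p us xs; have := xs; rewrite -index_mem => lt.
rewrite next_nth xs -[nth c p _]/(nth c (c :: p) (index x (c :: p)).+1).
have [lt'|ge] := ltnP (index x (c :: p)).+1 (size (c :: p)).
  by rewrite index_uniq // modn_small.
have -> : (index x (c :: p)).+1 = size (c :: p) by apply/eqP;
  rewrite eqn_leq lt ge.
by rewrite modnn nth_default // /= eqxx.
Qed.

Lemma next_next s x : uniq s -> 2 < size s -> x \in s -> next s (next s x) != x.
Proof.
move=> us s2 xs; apply/eqP=> /(congr1 (index^~ s)).
rewrite !index_next ?mem_next //.
have : index x s < size s by rewrite index_mem.
move: (index x s) (size s) s2 => i m m2 im.
have [im1|im1] := eqVneq i.+1 m.
  by rewrite im1 modnn modn_small; move: im1 m2; clear; lia.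
rewrite (modn_small (_ : i.+1 < m)); last by move: im im1; clear; lia.
have [im2|im2] := eqVneq i.+2 m; first by rewrite im2 modnn; move: im2 m2;
  clear; lia.
by rewrite modn_small; move: im im1 im2; clear; lia.
Qed.

Lemma cycle_adjP s x y : uniq s -> x \in s -> y \in s ->
  cycle_adj (size s) (index x s)
    (index y s) = (y == next s x) || (x == next s y).
Proof.
move=> us xs ys; rewrite /cycle_adj !index_mem xs ys /=.
have idx a b : a \in s -> b \in s -> (index a s == index b s) = (a == b).
  move=> aS bS; apply/eqP/eqP => [ab|-> //].
  by rewrite -(nth_index a aS) ab nth_index.
by rewrite -!index_next // !idx ?mem_next.
Qed.

(** A path in A minus c between two neighbours of c closes to a cycle. No vertex on it has a third
    neighbour, so the cycle has no chord and, A being connected, misses no vertex. *)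
Lemma spanning_cycle A c : two_connected A ->
  {in A, forall x, deg_on A x <= 2} -> c \in A ->
  exists p, [/\ uniq (c :: p), c :: p =i A &
    {in A &, forall x y,
       e x y = cycle_adj (size p).+1 (index x (c :: p)) (index y (c :: p))}].
Proof.
move=> tA deg2 cinA; have := tc_deg tA cinA.
case/card_gt1P=> a [b []]; rewrite !inE => /andP[aA eca] /andP[bA ecb] ab.
have ac : a != c by apply: contraTneq eca => ->; rewrite e_irr.
have bc : b != c by apply: contraTneq ecb => ->; rewrite e_irr.
have [] := @first_hit (A :\ c) [set b] a b; rewrite ?inE ?ac ?eqxx //.
  case/andP: (tA) => _ /forallP/(_ c)/connected_onP; apply;
    rewrite !inE ?ac ?bc //.
move=> p [z [ep up sub /setIP[_ /set1P->]]] lb.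
pose s := c :: a :: rcons p b.
have sE : s = c :: rcons (a :: p) b by [].
have us : uniq s.
  rewrite sE cons_uniq mem_rcons in_cons negb_or eq_sym bc rcons_uniq up andbT /=.
  by apply/andP; split; apply/negP=> /sub; rewrite !inE eqxx ?andbF.
have es : cycle e s by rewrite /s /= !rcons_path last_rcons eca ep lb e_sym ecb.
have s2 : 2 < size s by rewrite /s /= size_rcons.
have sA x : x \in s -> x \in A.
  rewrite sE inE mem_rcons in_cons => /or3P[/eqP->//|/eqP->//|/sub].
  by case/setDP=> /setD1P[].
have nbr x y : x \in s -> y \in A -> e x y ->
  (y == next s x) || (x == next s y).
  move=> xs yA exy; apply/norP=> -[yn xn].
  have xA := sA x xs.
  have := deg2 x xA; rewrite leqNgt => /negP; apply.
  have yp : y != prev s x by apply: contraNneq xn => ->; rewrite next_prev.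
  have np : next s x != prev s x.
    apply: contraTneq (next_next us s2 (_ : prev s x \in s));
      last by rewrite mem_prev.
    by move=> nE; rewrite next_prev // nE eqxx.
  have -> : 3 = #|y |: [set next s x; prev s x]|.
    by rewrite cardsU1 cards2 !inE np (negPf yn) (negPf yp).
  apply/subset_leq_card/subsetP=> w; rewrite !inE => /or3P[]/eqP->.
  - by rewrite yA.
  - by rewrite sA ?mem_next // next_cycle.
  - by rewrite sA ?mem_prev // e_sym prev_cycle.
have memE : s =i A.
  move=> x; apply/idP/idP => [/sA//|xA].
  have /connectP[q qA ->] := connected_onP _ (tc_con tA) _ _ cinA xA.
  suff stay w : path (induced A) w q -> w \in s -> last w q \in s.
    by apply: stay; rewrite ?mem_head.
  elim: q w {qA} => //= y q IH w /andP[/and3P[wA yA ewy] qA] ws.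
  apply: IH => //; case/orP: (nbr _ _ ws yA ewy) => /eqP.
    by move->; rewrite mem_next.
  by move=> wE; move: ws; rewrite wE mem_next.
exists (a :: rcons p b); split=> // x y xA yA.
have xs : x \in s by rewrite memE.
have ys : y \in s by rewrite memE.
rewrite -[_.+1]/(size s) cycle_adjP //; apply/idP/idP; first exact: nbr.
by case/orP=> /eqP->; rewrite ?next_cycle // e_sym next_cycle.
Qed.

Lemma isomorphic_nat n (f : rel nat) (h : T -> nat) :
  #|T| = n -> injective h -> (forall x, h x < n) ->
  (forall x y, f (h x) (h y) = e x y) ->
  isomorphic e (fun i j : 'I_n => f i j).
Proof.
move=> Tn hI hn fe; exists (fun x => Ordinal (hn x)) => [|x y]; last exact: fe.
apply: inj_card_bij; last by rewrite card_ord Tn.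
by move=> x y /(congr1 val); apply: hI.
Qed.

Lemma deg2_is_cycle : two_connected [set: T] ->
  (forall x, deg_on [set: T] x <= 2) -> is_cycle e.
Proof.
move=> tT deg2; have T2 : 2 < #|[set: T]| by case/andP: tT.
have [c _] : exists c, c \in [set: T] by apply/card_gt0P; apply: leq_trans T2.
have [|p [us memE adj]] := spanning_cycle tT _ (in_setT c); first by move=> x _.
have szE : #|T| = (size p).+1.
  by rewrite -cardsT -(eq_card memE) (card_uniqP us).
exists (size p).+1; first by rewrite -szE -cardsT.
apply: (@isomorphic_nat _ _ (fun x => index x (c :: p))) => //.
- by move=> x y; apply: (@index_inj T c (c :: p) x y); rewrite memE inE.
- by move=> x; rewrite -[(size p).+1]/(size (c :: p)) index_mem memE inE.
- by move=> x y; rewrite adj ?inE.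
Qed.

Lemma tc3_adj A x y : two_connected A -> #|A| = 3 -> x \in A -> y \in A ->
  x != y -> e x y.
Proof.
move=> tA A3 xA yA xy.
have sub : [set z in A | e x z] \subset A :\ x.
  apply/subsetP=> z; rewrite !inE => /andP[-> exz]; rewrite andbT.
  by apply: contraTneq exz => ->; rewrite e_irr.
have /eqP E : [set z in A | e x z] == A :\ x.
  rewrite eqEcard sub; have -> : #|A :\ x| = 2.
    by have := cardsD1 x A; rewrite A3 xA => -[].
  exact: tc_deg.
by have : y \in A :\ x; [rewrite !inE eq_sym xy | rewrite -E inE => /andP[]].
Qed.

(** The far side is numbered along its spanning cycle starting with c, which gets 0; the other two
    vertices of the triangle get n - 2 and n - 1. *)
Lemma glue_iso n c B : #|T| = n -> 4 < n -> separation [set: T] c B ->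
  #|B| = 3 ->
  two_connected B -> two_connected (far_side [set: T] c B) ->
  {in far_side [set: T] c B, forall x, deg_on (far_side [set: T] c B) x <= 2} ->
  isomorphic e (@Cn3 n).
Proof.
move=> Tn n4 S B3 tB tB' deg2; have [cB _ _ _ nE] := separationP S.
have [cB' _ _ _ _] := separationP (sep_other S).
have cardB' := card_other S; set B' := far_side _ c B in tB' deg2 cB' cardB' *.
have [p [us memE adj]] := spanning_cycle tB' deg2 cB'.
have szE : (size p).+1 = n - 2.
  rewrite -[LHS]/(size (c :: p)) -(card_uniqP us) (eq_card memE).
  by move: cardB'; rewrite cardsT Tn B3; move: #|B'| n4; clear; lia.
have : #|B :\ c| = 2 by have := cardsD1 c B; rewrite B3 cB => -[].
move=> /eqP/cards2P[a1 [a2 [a12 BE]]].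
have [a1c a1B] : a1 != c /\ a1 \in B.
  by apply/setD1P; rewrite BE !inE eqxx.
have [a2c a2B] : a2 != c /\ a2 \in B.
  by apply/setD1P; rewrite BE !inE eqxx orbT.
have B'P x : (x \in B') = (x != a1) && (x != a2).
  rewrite !inE andbT; have := in_setD1 x B c; rewrite BE !inE.
  have [-> _|xc /= <-] := eqVneq x c; last by rewrite negb_or.
  by rewrite ![c == _]eq_sym a1c a2c.
have Tcase x : [\/ x \in B', x = a1 | x = a2].
  have [->|x1] := eqVneq x a1; first by apply: Or32.
  by have [->|x2] := eqVneq x a2; [apply: Or33 | apply: Or31; rewrite B'P x1].
have [a1B' a2B'] : a1 \notin B' /\ a2 \notin B'.
  by rewrite !B'P !eqxx ?andbF.
pose h x := if x \in B' then index x
  (c :: p) else if x == a1 then n - 2 else n - 1.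
have hB' x : x \in B' -> h x = index x (c :: p) /\ h x < n - 2.
  by move=> xB'; rewrite /h xB' -szE -[(size p).+1]/(size
    (c :: p)) index_mem memE.
have ha1 : h a1 = n - 2 by rewrite /h (negPf a1B') eqxx.
have ha2 : h a2 = n - 1 by rewrite /h (negPf a2B') eq_sym (negPf a12).
have n1 : (n - 2 == n - 1) = false by move: n4; clear; lia.
have n12 : n - 2 <= n - 1 by apply: leq_sub2l.
have n1' : (n - 1 == n - 2) = false by move: n4; clear; lia.
have hc x : x \in B' -> (h x == 0) = (x == c).
  by move=> xB'; rewrite (hB' x xB').1 /= [c == x]eq_sym; case: (x == c).
have ea x a : x \in B' -> a \in B -> a != c -> e a x = (x == c).
  move=> xB' aB ac; have [->|xc] := eqVneq x c.
    by apply: (tc3_adj tB B3).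
  apply/negbTE/nE => //; move: xB'; rewrite !inE (negPf xc) /=.
  by case/andP.
pose f i j := cycle_adj (n - 2) i j ||
  [&& i \in [:: 0; n - 2; n - 1], j \in [:: 0; n - 2; n - 1] & i != j].
have fs i j : f i j = f j i.
  rewrite /f /cycle_adj [i == j]eq_sym [_ || (i == _)]orbC.
  by do 2!case: (_ < _); do 2!case: (_ \in _).
apply: (@isomorphic_nat n f h) => //.
- move=> x y; case: (Tcase x) => [xB'|->|->]; case: (Tcase y) => [yB'|->|->] //.
  + have [-> _] := hB' x xB'; have [-> _] := hB' y yB'.
    by apply: (@index_inj T c (c :: p) x y); rewrite memE.
  + by rewrite ha1 => hx; have [_] := hB' x xB'; rewrite hx ltnn.
  + by rewrite ha2 => hx; have [_] := hB' x xB'; rewrite hx; move: n4; clear;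
    lia.
  + by rewrite ha1 => hx; have [_] := hB' y yB'; rewrite -hx ltnn.
  + by rewrite ha1 ha2 => /eqP; rewrite n1.
  + by rewrite ha2 => hx; have [_] := hB' y yB'; rewrite -hx; move: n4; clear;
    lia.
  + by rewrite ha1 ha2 => /eqP; rewrite n1'.
- move=> x; case: (Tcase x) => [xB'|->|->]; rewrite ?ha1 ?ha2.
  + by apply: leq_trans (hB' x xB').2 _; apply: leq_subr.
  + by move: n4; clear; lia.
  + by move: n4; clear; lia.
have fB' x y : x \in B' -> y \in B' -> f (h x) (h y) = e x y.
  move=> xB' yB'; rewrite adj // szE -(hB' x xB').1 -(hB' y yB').1 /f !inE.
  rewrite (ltn_eqF (hB' x xB').2) (ltn_eqF (hB' y yB').2).
  have l1 z : z \in B' -> (h z == n - 1) = false.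
    by move=> zB'; apply/ltn_eqF/(leq_trans (hB' z zB').2).
  rewrite !l1 // !orbF; case: eqP => [->|]; rewrite ?orbF //=.
  by case: eqP => [->|]; rewrite ?orbF //=.
have fa (a : nat) x : x \in B' -> a \in [:: n - 2;
  n - 1] -> f a (h x) = (h x == 0).
  move=> xB' aa; have [_ hx] := hB' x xB'.
  have an : n - 2 <= a by move: aa; rewrite !inE => /orP[]/eqP->; move: n4;
    clear; lia.
  rewrite /f /cycle_adj ltnNge an /= in_cons aa orbT /=.
  rewrite gtn_eqF ?(leq_trans hx) // andbT !inE (ltn_eqF hx).
  by rewrite (ltn_eqF (leq_trans hx n12)) !orbF.
have faa : f (n - 2) (n - 1).
  by rewrite /f !inE n1 !eqxx !orbT.
have fii i : n - 2 <= i -> f i i = false.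
  by rewrite /f /cycle_adj ltnNge => -> /=; rewrite eqxx !andbF.
have m1 : n - 2 \in [:: n - 2; n - 1] by rewrite !inE eqxx.
have m2 : n - 1 \in [:: n - 2; n - 1] by rewrite !inE eqxx orbT.
move=> x y; case: (Tcase x) => [xB'|->|->]; case: (Tcase y) => [yB'|->|->];
  rewrite ?ha1 ?ha2 ?e_irr ?fii ?leq_sub2l //.
- exact: fB'.
- by rewrite fs fa // hc // e_sym ea.
- by rewrite fs fa // hc // e_sym ea.
- by rewrite fa // hc // ea.
- by rewrite faa (tc3_adj tB B3).
- by rewrite fa // hc // ea.
- by rewrite fs faa (tc3_adj tB B3) // eq_sym.
Qed.

End Graph.

(** * The Wiener index of C_{n,3} *)

(** A potential growing by at most one per edge cannot exceed the length of a path. The bound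
    [g y <= #|T|] covers an unreachable y, where [dist] has its default value. *)
Lemma dist_ge_potential (T : finType) (r : rel T) (g : T -> nat) x y :
  g x = 0 -> (forall a b, r a b -> g b <= (g a).+1) -> g y <= #|T| ->
  g y <= dist r x y.
Proof.
move=> gx gS gy; have [/dist_pathP[p rp [<- <-]]|nxy] := boolP (connect r x y).
  suff : g (last x p) <= g x + size p by rewrite gx.
  elim: p x rp {gx} => [|z p IH] x /=; first by rewrite addn0.
  case/andP=> rxz rp; apply: leq_trans (IH _ rp) _.
  by rewrite addnS -addSn leq_add2r gS.
rewrite /dist hasNfind ?size_iota //; apply/hasPn=> k _; apply/negP.
move=> /existsP[p /and3P[rp _ /eqP lp]]; case/negP: nxy.
by apply/connectP; exists p.
Qed.

Definition cyc_dist m i j := minn ((i - j) + (j - i)) (m - ((i - j) + (j - i))).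

(** The row of 0 is [sum_min]; raising i by one shifts the row cyclically by one place. *)
Lemma sum_cyc_dist m i : i < m -> \sum_(j < m) cyc_dist m i j = quarter m.
Proof.
case: m => // m; elim: i => [_|i IH im].
  rewrite big_ord_recl /cyc_dist /= -sum_min add0n; apply: eq_bigr => j _.
  by have := ltn_ord j; rewrite /bump /=; lia.
rewrite -IH; last exact: ltnW.
rewrite big_ord_recl big_ord_recr /= [LHS]addnC.
rewrite (eq_bigr (fun k : 'I_m => cyc_dist m.+1 i k)); last first.
  by move=> k _; rewrite /cyc_dist /bump /=; lia.
by rewrite /cyc_dist; lia.
Qed.

(* Distance in C_(m+2),3; the vertices m and m + 1 hang at the vertex 0. *)
Definition Cn3_dist m i j :=
  if i == j then 0
  else if (m <= i) && (m <= j) then 1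
  else cyc_dist m (if i < m then i else 0) (if j < m then j else 0) +
       (m <= i) + (m <= j).

Lemma Cn3_dist_sym m i j : Cn3_dist m i j = Cn3_dist m j i.
Proof.
by rewrite /Cn3_dist eq_sym andbC addnAC /cyc_dist [_ - _ + _]addnC.
Qed.

Lemma Cn3_dist_le m i j : 0 < m -> Cn3_dist m i j <= m.+2.
Proof. by move=> m0; rewrite /Cn3_dist /cyc_dist; case: eqP => // _;
  case: ifP; lia. Qed.

Lemma sum_Cn3_dist m : 0 < m ->
  \sum_(i < m.+2) \sum_(j < m.+2) Cn3_dist m i j = wiener2 m.+2.
Proof.
move=> m0.
have inner i : i < m -> \sum_(j < m) Cn3_dist m i j = quarter m.
  move=> im; rewrite -(sum_cyc_dist im); apply: eq_bigr => j _.
  rewrite /Cn3_dist im ltn_ord (leqNgt m i) (leqNgt m j) im ltn_ord /= !addn0.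
  by case: eqP => // ->; rewrite /cyc_dist subnn min0n.
have outer k : m <= k -> \sum_(j < m) Cn3_dist m k j = quarter m + m.
  move=> mk; rewrite -{1}(sum_cyc_dist m0) -[X in _ + X](card_ord m) -sum1_card.
  rewrite -big_split /=; apply: eq_bigr => j _; have jm := ltn_ord j.
  rewrite /Cn3_dist mk ltnNge mk /= (leqNgt m j) jm /= addn0.
  by rewrite gtn_eqF // (leq_trans jm).
have row k : \sum_(j < m.+2) Cn3_dist m k j =
    \sum_(j < m) Cn3_dist m k j + Cn3_dist m k m + Cn3_dist m k m.+1.
  by rewrite !big_ord_recr.
rewrite 2!big_ord_recr /= !row !outer //.
rewrite (eq_bigr (fun i : 'I_m =>
  quarter m + Cn3_dist m m i + Cn3_dist m m.+1 i)).
  2: by move=> i _;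
    rewrite row inner // [Cn3_dist m i m]Cn3_dist_sym [Cn3_dist m i m.+1]Cn3_dist_sym.
rewrite !big_split /= sum_nat_const card_ord.
rewrite !outer // /Cn3_dist !eqxx !leqnn !leqnSn /= /wiener2.
rewrite (_ : m.+2 - 2 = m); last by clear; lia.
rewrite [m.+1 == m]gtn_eqF // [m == m.+1]ltn_eqF //.
by move: (quarter m) => f; clear; lia.
Qed.

(** This makes the distance formula a potential for [dist_ge_potential]. *)
Lemma Cn3_dist_edge m i a b : 2 < m ->
  cycle_adj m a b || [&& a \in [:: 0; m; m.+1], b \in [:: 0; m;
    m.+1] & a != b] ->
  Cn3_dist m i b <= (Cn3_dist m i a).+1.
Proof.
move=> m2 /orP[/and3P[am bm ab]|].
  have E : b = a.+1 \/ a = b.+1 \/ a = m.-1 /\ b = 0 \/ b = m.-1 /\ a = 0.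
    have step x y : x < m -> y == x.+1 %% m -> y = x.+1 \/ x = m.-1 /\ y = 0.
      move=> xm /eqP->; have [xm1|xm1] := eqVneq x.+1 m.
        by right; rewrite xm1 modnn -xm1.
      by left; rewrite modn_small // ltn_neqAle xm1.
    by case/orP: ab => /step; [case/(_ am)|case/(_ bm)]; tauto.
  rewrite /Cn3_dist am bm (leqNgt m a)
    (leqNgt m b) am bm /= !andbF !addn0 /cyc_dist.
  case: (ltnP i m) => im /=; case: (eqVneq i b) => [//|ib];
    case: (eqVneq i a) => [ia|ia];
    move: E am bm im ib ia m2; clear; lia.
have m0 : 0 < m by apply: leq_trans m2.
have m0' : (m <= 0) = false by rewrite leqNgt m0.
have m1 : (m.+1 < m) = false by rewrite ltnNge leqnSn.
rewrite !inE /Cn3_dist => /and3P[/or3P[]/eqP-> /or3P[]/eqP->] //;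
  rewrite ?eqxx // => _;
  rewrite ?m0 ?m0' ?m1 ?leqnn ?leqnSn ?ltnn ?andbF ?andbT ?addn0 /cyc_dist;
  case: (ltnP i m) => im; (case: eqVneq => [?|?] //=;
    try case: eqVneq => [?|?] //=);
  move: im m2; subst; clear; lia.
Qed.

Lemma wiener_double (T : finType) (r : rel T) :
  (forall x y, dist r x y = dist r y x) ->
  2 * wiener r = \sum_x \sum_y dist r x y.
Proof.
move=> rs; have := @sum_sym T [set: T] (dist r).
move=> /(_ (fun x y _ _ => rs x y) (fun x _ => dist_refl r x)) H.
rewrite /wiener mul2n;
  transitivity (\sum_(x in [set: T]) \sum_(y in [set: T]) dist r x y).
  rewrite H; congr _.*2; apply: eq_big => [x|x _]; first by rewrite inE.
  by apply: eq_bigl => y; rewrite inE.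
by apply: eq_big => [x|x _]; rewrite ?inE //; apply: eq_bigl => y; rewrite inE.
Qed.

(** The formula [Cn3_dist] serves as a potential from every vertex. This direction suffices for the
    theorem, since the Wiener index of G is compared with [wiener2 n] directly. *)
Lemma wiener_Cn3_lb n : 4 < n -> wiener2 n <= 2 * wiener (@Cn3 n).
Proof.
case: n => [|[|m]] // m2.
have m0 : 2 < m by [].
rewrite -sum_Cn3_dist; last exact: leq_trans m0.
have S := @sum_sym _ [set: 'I_m.+2] (fun i j => Cn3_dist m i j).
have -> : \sum_(i < m.+2) \sum_(j < m.+2) Cn3_dist m i j =
  \sum_(i in [set: 'I_m.+2]) \sum_(j in [set: 'I_m.+2]) Cn3_dist m i j.
  by apply: eq_big => [i|i _]; rewrite ?inE //; apply: eq_bigl => j;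
    rewrite inE.
rewrite S; last by move=> i _; rewrite /Cn3_dist eqxx.
  rewrite -mul2n leq_pmul2l // /wiener.
  rewrite (eq_bigl xpredT); last by move=> i; rewrite inE.
  apply: leq_sum => i _; rewrite (eq_bigl (fun j => enum_rank i < enum_rank j));
    last by move=> j; rewrite inE.
  apply: leq_sum => j _.
  apply: (@dist_ge_potential _ _ (fun j : 'I_m.+2 => Cn3_dist m i j)).
  - by rewrite /Cn3_dist eqxx.
  - move=> a b; rewrite /Cn3 => ab; apply: Cn3_dist_edge => //.
    by move: ab; rewrite subSS subn1 /= subSS subn0.
  - by rewrite card_ord Cn3_dist_le //; apply: leq_trans m0.
by move=> i j _ _; apply: Cn3_dist_sym.
Qed.

(** * Conclusion for the whole graph *)

Lemma induced_setT (T : finType) (e : rel T) : induced e [set: T] =2 e.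
Proof. by move=> x y; rewrite /induced !inE. Qed.

Lemma wiener_W2 (T : finType) (e : rel T) :
  symmetric e -> connected_graph e -> 2 * wiener e = dist_total e [set: T].
Proof.
move=> e_sym e_con; rewrite wiener_double; last by move=> x y; apply: dist_sym.
apply: eq_big => [x|x _]; rewrite ?inE //.
apply: eq_big => [y|y _]; rewrite ?inE //.
by rewrite (eq_dist (induced_setT e)).
Qed.

Lemma wiener_iso (T U : finType) (e : rel T) (f : rel U) :
  symmetric e -> connected_graph e -> isomorphic e f -> wiener e = wiener f.
Proof.
move=> e_sym e_con [h bij_h fe]; have [g gK hK] := bij_h.
have dE x y : dist f (h x) (h y) = dist e x y by apply: dist_iso.
have f_sym x y : dist f x y = dist f y x.
  by rewrite -[x]hK -[y]hK !dE; apply: dist_sym.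
apply/eqP; rewrite -(eqn_pmul2l (isT : 0 < 2)) !wiener_double //.
  rewrite (reindex h) /=; last exact: onW_bij.
  apply/eqP; apply: eq_bigr => x _; rewrite [RHS](reindex h) /=;
    last exact: onW_bij.
  by apply: eq_bigr => y _; rewrite dE.
by move=> x y; apply: dist_sym.
Qed.

(** Each distance sum is at most [quarter #|A|], and that of a vertex of degree at least 3 stays
    below by [tc_sg_strict]. *)
Lemma tc_W2_eq_deg (T : finType) (e : rel T) (A : {set T}) :
  irreflexive e -> two_connected e A -> 3 < #|A| ->
    dist_total e A = #|A| * quarter #|A| ->
  {in A, forall x, deg_on e A x <= 2}.
Proof.
move=> e_irr tA A3 WA x xA; rewrite leqNgt; apply/negP=> dx.
suff : dist_total e A < #|A| * quarter #|A| by rewrite WA ltnn.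
rewrite -sum_nat_const /dist_total
  (bigD1 x) //= [X in _ < X](bigD1 x) //= -addSn.
rewrite leq_add ?tc_sg_strict //; apply: leq_sum => y /andP[yA _].
exact: tc_sg.
Qed.

Lemma noncycle_W2 n (T : finType) (e : rel T) :
  26 <= n -> #|T| = n -> simple_graph e -> eulerian e -> ~ is_cycle e ->
  dist_total e [set: T] <= wiener2 n /\
  (dist_total e [set: T] = wiener2 n -> isomorphic e (@Cn3 n)).
Proof.
move=> n26 Tn [e_sym e_irr] [e_con e_even] ncyc.
have cT : connected_on e [set: T].
  by apply/connected_onP=> x y _ _; rewrite (eq_connect (induced_setT e)).
have evT : even_on e [set: T].
  apply/forall_inP=> x _; have := e_even x; rewrite /degree /deg_on.
  by rewrite (_ : [set y in _ | _] = [set y | e x y]) //; apply/setP=> y;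
    rewrite !inE.
have Tn' : #|[set: T]| = n by rewrite cardsT.
have strict : dist_total e [set: T] < wiener2 n ->
  dist_total e [set: T] <= wiener2 n /\
    (dist_total e [set: T] = wiener2 n -> isomorphic e (@Cn3 n)).
  by move=> lt; split; [apply: ltnW | move=> E; rewrite E ltnn in lt].
have [tT|nT] := boolP (two_connected e [set: T]).
  apply: strict; have [/existsP[x dx]|] :=
    boolP [exists x, 2 < deg_on e [set: T] x].
    by rewrite -Tn'; apply: (tc_W2_lt e_sym e_irr tT evT (in_setT x) dx);
      rewrite Tn'.
  move=> /existsPn deg2; case: ncyc; apply: (deg2_is_cycle e_sym e_irr tT) => x.
  by rewrite leqNgt.
have [] := extremal_split e_sym e_irr cT evT _ nT; rewrite ?Tn' // => -[le].
case=> c [B [S B3 tB tB' eqW]]; split=> // /eqW WB'.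
have n4 : 4 < n by apply: leq_trans n26.
apply: (glue_iso e_sym e_irr Tn n4 S B3 tB tB').
apply: tc_W2_eq_deg => //.
have := card_other S; rewrite Tn' B3.
by move: #|_|; move: n26; clear; lia.
Qed.

Theorem theorem2 (n : nat) (T : finType) (e : rel T) :
  26 <= n -> #|T| = n -> simple_graph e -> eulerian e -> ~ is_cycle e ->
  wiener e <= wiener (@Cn3 n) /\
  (wiener e = wiener (@Cn3 n) <-> isomorphic e (@Cn3 n)).
Proof.
move=> n26 Tn e_simple e_euler ncyc.
have [e_sym _] := e_simple; have [e_con _] := e_euler.
have [le eq_iso] := noncycle_W2 n26 Tn e_simple e_euler ncyc.
have lb : wiener2 n <= 2 * wiener (@Cn3 n).
  by apply: wiener_Cn3_lb; apply: leq_trans n26.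
rewrite -wiener_W2 // in le eq_iso; split.
  by rewrite -(leq_pmul2l (isT : 0 < 2)) (leq_trans le lb).
split=> [eqW|]; last exact: wiener_iso.
(* The chain [wiener2 n] <= 2 W(C_{n,3}) = 2 W(G) <= [wiener2 n] gives equality throughout. *)
by apply: eq_iso; apply/eqP; rewrite eqn_leq le eqW.
Qed.
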